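(* Let $\mathcal{F}$ be a family of closure systems (on finite universes of unbounded cardinality) that enjoys the disjoint extension property, and let $c\ge 1$ be the corresponding exponent. Then there is an algorithm $\mathcal{A}$ which, for any closure system $\mathcal{C}\in\mathcal{F}$, $\mathcal{C}\subseteq \mathcal{P}([w])$, that comes equipped with an implicational base $\Sigma$ having $h\ge 1$ elements, and for any $k\in[w]$, enumerates the $N$ many sets $X\in\mathcal{C}$ with $|X|=k$ in output-polynomial time $$O\big((N+1)\,h\,s\,(hw+w^{c})\big),$$ where $s=\max\{|A|+1 : (A\to B)\in\Sigma\}$.
   Context: $[w]=\{1,2,\dots,w\}$ and $\mathcal{P}(W)$ is the powerset of $W$. A closure system on a finite set $W$ is a family $\mathcal{C}\subseteq\mathcal{P}(W)$ with $W\in\mathcal{C}$ and such that $X,Y\in\mathcal{C}$ implies $X\cap Y\in\mathcal{C}$. An implication on $W$ is a pair $A\to B$ with $A,B\subseteq W$; $A$ is its premise and $B$ its conclusion. A set $X\subseteq W$ satisfies $A\to B$ if $A\subseteq X$ implies $B\subseteq X$. For a family $\Sigma$ of implications, $\mathrm{Mod}(\Sigma)$ is the closure system of all $X\subseteq W$ that satisfy every member of $\Sigma$. $\Sigma$ is an implicational base of $\mathcal{C}$ if $\mathcal{C}=\mathrm{Mod}(\Sigma)$. Disjoint extension property of a family $\mathcal{F}$ of closure systems: there is $c\ge 1$ such that for all $\mathcal{C}\in\mathcal{F}$ (with universe $W$, $w=|W|$), all $Z_0\in\mathcal{C}$, all $Y\subseteq W$ and all $k\le w$, it can be checked in time $O(w^c)$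 whether there is $Z\in\mathcal{C}$ with $Z_0\subseteq Z$, $|Z|=k$ and $Y\cap Z=\emptyset$. To enumerate a collection of sets means to produce (list) all of them, one by one. *)

(* Defs.v *)
From HB Require Import structures.
From mathcomp Require Import all_boot all_order all_algebra.
From mathcomp Require Import reals exp.

Set Implicit Arguments.
Unset Strict Implicit.
Unset Printing Implicit Defensive.

Import Order.TTheory GRing.Theory Num.Theory.

Local Open Scope nat_scope.

(** * Closure systems and implications *)

Definition closure_system (W : finType) (C : {set {set W}}) : Prop :=
  setT \in C /\ (forall X Y, X \in C -> Y \in C -> X :&: Y \in C).

(* The pair (A, B) is the implication A -> B. *)
Definition implication (W : finType) : Type := ({set W} * {set W})%type.

Definition satisfies (W : finType) (X : {set W}) (r : implication W) : bool :=
  (r.1 \subset X) ==> (r.2 \subset X).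

Definition Mod (W : finType) (Sigma : seq (implication W)) : {set {set W}} :=
  [set X | all (satisfies X) Sigma].

Definition implicational_base (W : finType) (Sigma : seq (implication W))
  (C : {set {set W}}) : Prop := C = Mod Sigma.

(** * Random access machine

    Algorithms are structured programs for a unit-cost random access machine.
    The memory is split into banks; cell [a] of bank [b] is addressed by
    [(b, a)].  The bank of an access is a literal of the program, so that a
    given program uses finitely many banks, whereas the address inside the bank
    is computed (indirect addressing).  Cells hold natural numbers.  As usual
    for unit-cost machines, only addition and (truncated) subtraction are
    primitive; multiplication is not. *)

Definition store : Type := nat -> nat -> nat.

Definition update (m : store) (b a v : nat) : store :=
  fun b' a' => if (b' == b) && (a' == a) then v else m b' a'.

Inductive expr : Type :=
| ECst of nat
| EGet of nat & expr
| EAdd of expr & expr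
| ESub of expr & expr.

Fixpoint eval (m : store) (e : expr) : nat :=
  match e with
  | ECst n => n
  | EGet b e1 => m b (eval m e1)
  | EAdd e1 e2 => eval m e1 + eval m e2
  | ESub e1 e2 => eval m e1 - eval m e2
  end.

Fixpoint ecost (e : expr) : nat :=
  match e with
  | ECst _ => 1
  | EGet _ e1 => (ecost e1).+1
  | EAdd e1 e2 | ESub e1 e2 => (ecost e1 + ecost e2).+1
  end.

(* [CSet b e1 e2] writes the value of [e2] to the cell of bank [b] whose address
   is the value of [e1]; [COut e] appends the value of [e] to the output; tests
   succeed on nonzero values. *)
Inductive cmd : Type :=
| CSkip
| CSet of nat & expr & expr
| COut of expr
| CSeq of cmd & cmd
| CIf of expr & cmd & cmd
| CWhile of expr & cmd.

(* [exec p m m' out t]: started in memory [m], the program [p] halts after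
   exactly [t] steps in memory [m'], having written [out]. *)
Inductive exec : cmd -> store -> store -> seq nat -> nat -> Prop :=
| ExSkip m : exec CSkip m m [::] 1
| ExSet m b e1 e2 :
    exec (CSet b e1 e2) m (update m b (eval m e1) (eval m e2)) [::]
         (ecost e1 + ecost e2).+1
| ExOut m e : exec (COut e) m m [:: eval m e] (ecost e).+1
| ExSeq p1 p2 m m1 m2 out1 out2 t1 t2 :
    exec p1 m m1 out1 t1 -> exec p2 m1 m2 out2 t2 ->
    exec (CSeq p1 p2) m m2 (out1 ++ out2) (t1 + t2)
| ExIf m m' e p1 p2 out t :
    exec (if eval m e != 0 then p1 else p2) m m' out t ->
    exec (CIf e p1 p2) m m' out (ecost e + t).+1
| ExWhileF m e p :
    eval m e = 0 -> exec (CWhile e p) m m [::] (ecost e).+1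
| ExWhileT m m1 m2 e p out1 out2 t1 t2 :
    eval m e != 0 -> exec p m m1 out1 t1 -> exec (CWhile e p) m1 m2 out2 t2 ->
    exec (CWhile e p) m m2 (out1 ++ out2) (ecost e + t1 + t2).+1.

(* Bank [b] initially holds the [b]-th list of the input; all other cells
   are 0. *)
Definition load (inp : seq (seq nat)) : store :=
  fun b a => nth 0 (nth [::] inp b) a.

Definition runs (p : cmd) (inp : seq (seq nat)) (out : seq nat) (t : nat) :
  Prop := exists m', exec p (load inp) m' out t.

Lemma exec_det p m m1 m2 out1 out2 t1 t2 :
  exec p m m1 out1 t1 -> exec p m m2 out2 t2 ->
  [/\ m1 = m2, out1 = out2 & t1 = t2].
Proof.
move=> H; elim: H m2 out2 t2 => {p m m1 out1 t1}.
- by move=> m m2 o t H; inversion H.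
- by move=> m b e1 e2 m2 o t H; inversion H.
- by move=> m e m2 o t H; inversion H.
- move=> p1 p2 m m1 m2 o1 o2 t1 t2 _ IH1 _ IH2 m' o' t' H.
  inversion H as [| | |? ? ? ? ? ? ? ? ? E1 E2| | |]; subst.
  case: (IH1 _ _ _ E1) => ? ? ?; subst.
  by case: (IH2 _ _ _ E2) => ? ? ?; subst.
- move=> m m' e p1 p2 o t _ IH m2 o2 t2 H.
  inversion H as [| | | |? ? ? ? ? ? ? E| |]; subst.
  by case: (IH _ _ _ E) => ? ? ?; subst.
- move=> m e p e0 m2 o t H.
  inversion H as [| | | | | |? ? ? ? ? ? ? ? ? en0]; subst => //.
  by rewrite e0 in en0.
- move=> m m1 m2 e p o1 o2 t1 t2 en0 _ IH1 _ IH2 m' o' t' H.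
  inversion H as [| | | | |? ? ? e0|? ? ? ? ? ? ? ? ? ? E1 E2]; subst.
    by rewrite e0 in en0.
  case: (IH1 _ _ _ E1) => ? ? ?; subst.
  by case: (IH2 _ _ _ E2) => ? ? ?; subst.
Qed.

(** * Encoding of inputs and outputs *)

(* Characteristic 0/1-vector, of length w. *)
Definition chi (w : nat) (X : {set 'I_w}) : seq nat :=
  [seq nat_of_bool (x \in X) | x <- enum 'I_w].

(* Concatenation of the characteristic vectors; as an input, this is a 0/1-matrix
   in row-major order. *)
Definition chis (w : nat) (s : seq {set 'I_w}) : seq nat :=
  flatten [seq chi X | X <- s].

(** * Families of closure systems

    The members of a family are handed to algorithms in some presentation (a
    poset, a tree, a base and so on), modelled by the data [fam_code i].  This
    presentation is arbitrary.  The same closure system may occur for several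
    indices, i.e., it may have several presentations. *)
Record closure_family : Type := ClosureFamily {
  fam_idx : Type;
  fam_size : fam_idx -> nat;
  fam_sys : forall i : fam_idx, {set {set 'I_(fam_size i)}};
  fam_closure : forall i : fam_idx, closure_system (fam_sys i);
  fam_code : fam_idx -> seq nat
}.

Definition unbounded_universes (F : closure_family) : Prop :=
  forall n, exists i : fam_idx F, n <= fam_size i.

(** * Disjoint extension property *)

Definition check_input (w : nat) (d : seq nat) (Z0 Y : {set 'I_w}) (k : nat) :
  seq (seq nat) :=
  [:: [:: w; k; size d]; chi Z0; chi Y; d].

Definition has_disjoint_extension (w : nat) (C : {set {set 'I_w}})
  (Z0 Y : {set 'I_w}) (k : nat) : bool :=
  [exists Z in C, [&& Z0 \subset Z, #|Z| == k & Y :&: Z == set0]].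

(* One program, and one constant, serve all members of the family.  The empty
   universe is left out because w ^ c = 0 there. *)
Definition disjoint_extension_property (R : realType) (F : closure_family)
  (c : R) : Prop :=
  exists (P : cmd) (K : R),
    forall i : fam_idx F, 0 < fam_size i ->
    forall Z0 Y : {set 'I_(fam_size i)}, Z0 \in fam_sys i ->
    forall k : nat, k <= fam_size i ->
    exists t : nat,
      runs P (check_input (fam_code i) Z0 Y k)
             [:: nat_of_bool (has_disjoint_extension (fam_sys i) Z0 Y k)] t
      /\ (t%:R <= K * (fam_size i)%:R `^ c)%R.

(** * Enumeration *)

Definition enum_input (w : nat) (d : seq nat) (Sigma : seq (implication 'I_w))
  (k : nat) : seq (seq nat) :=
  [:: [:: w; k; size Sigma; size d];
      chis [seq r.1 | r <- Sigma]; chis [seq r.2 | r <- Sigma]; d].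

Definition enumerates (w : nat) (out : seq nat) (S : {set {set 'I_w}}) : Prop :=
  exists l : seq {set 'I_w}, [/\ uniq l, l =i S & out = chis l].

Definition members_of_size (w : nat) (C : {set {set 'I_w}}) (k : nat) :
  {set {set 'I_w}} := [set X in C | #|X| == k].

Definition max_premise_size1 (w : nat) (Sigma : seq (implication 'I_w)) : nat :=
  \max_(r <- Sigma) (#|r.1| + 1).

(* Main.v *)
(* A set is closed as soon as it contains the closure of its trace on the set D
   of all elements occurring in premises.  So a closed set is coded by 2w bits:
   its trace on D, then its trace on the elements that lie neither in D nor in
   the closure of the first trace.  The codes of the closed k-sets span a binary
   trie, which is searched depth first; only viable nodes (those with a k-set
   below) are expanded.  On the first w levels only elements of D branch, and
   viability is decided by closing the set of chosen elements with a
   linear-time counter algorithm and calling the disjoint extension oracle.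
   On the last w levels the undecided elements are unconstrained, and viability
   is a constant-time test on cardinalities.  Hence at most |D| + 1 <= h s
   expensive levels, each of cost O(hw + w^c), lie above every output.  The oracle
   runs on renamed banks with a log of its writes, which is undone afterwards in
   time proportional to its running time. *)
Require Import Defs.
From HB Require Import structures.
From mathcomp Require Import all_boot all_order all_algebra.
From mathcomp Require Import reals exp.
From mathcomp Require Import boolp zify.

Import Order.TTheory GRing.Theory Num.Theory.

Local Open Scope nat_scope.

Set Implicit Arguments.
Unset Strict Implicit.
Unset Printing Implicit Defensive.

(** * Program logic *)

(** Deciding all elements in one pass would call the oracle on up to w levels above an output.
    Postponing the elements outside D leaves only the levels of D, and |D| is at most the sum of the
    premise sizes, hence at most h(s - 1). The oracle wants a closed [Z0], so the chosen elements
    are closed first; the refused elements of D form its [Y]. The search is one flat loop, so what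
    was computed at a node must still be right when the loop returns there. Beyond depth w the
    cardinality bounds sit in arrays indexed by depth, and a parent's entries survive its subtrees.
    Up to depth w nothing is kept on return: a second child either recomputes its closure (last
    position in D) or is refused on sight (last position outside D). Time is charged to outputs.
    Only viable nodes are expanded, so the tests of both children can be charged to an output below;
    the 1 in N + 1 pays for the preparation and the root. *)

Fixpoint writes (p : cmd) (b : nat) : bool :=
  match p with
  | CSkip | COut _ => false
  | CSet b' _ _ => b == b'
  | CSeq p q | CIf _ p q => writes p b || writes q b
  | CWhile _ p => writes p b
  end.

Lemma exec_frame {p m m' o t} : exec p m m' o t ->
  forall b, ~~ writes p b -> m' b =1 m b.
Proof.
elim=> {p m m' o t} //.
- by move=> m b e1 e2 b' /= /negbTE nb a; rewrite /update nb.
- move=> p1 p2 m m1 m2 _ _ _ _ _ IH1 _ IH2 b /= /norP[n1 n2] a.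
  by rewrite IH2 ?IH1.
- move=> m m' e p1 p2 o t _ IH b /= /norP[n1 n2] a; apply: IH.
  by case: ifP.
- by move=> m m1 m2 e p o1 o2 t1 t2 _ _ IH1 _ IH2 b /= nb a; rewrite IH2 ?IH1.
Qed.

Fixpoint silent (p : cmd) : bool :=
  match p with
  | CSkip | CSet _ _ _ => true
  | COut _ => false
  | CSeq p q | CIf _ p q => silent p && silent q
  | CWhile _ p => silent p
  end.

Lemma exec_silent {p m m' o t} : exec p m m' o t -> silent p -> o = [::].
Proof.
elim=> {p m m' o t} //=.
- by move=> p1 p2 m m1 m2 o1 o2 t1 t2 _ IH1 _ IH2 /andP[/IH1-> /IH2->].
- by move=> m m' e p1 p2 o t _ IH /andP[s1 s2]; apply: IH; case: ifP.
- by move=> m m1 m2 e p o1 o2 t1 t2 _ _ IH1 _ IH2 s; rewrite IH1 ?IH2.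
Qed.

(** Total correctness: termination, output and exact time are part of the claim. As [exec] is
    deterministic, the existential form is as strong as a universal one together with
    termination. *)
Definition wp (p : cmd) (m : store) (Q : store -> seq nat -> nat -> Prop) :=
  exists m' o t, exec p m m' o t /\ Q m' o t.

(** The execution is handed on with its postcondition, so that [exec_frame] and [exec_silent] apply
    afterwards; specifications need not list what a program leaves alone. *)
Lemma wp_conseq {p m} {Q Q' : store -> seq nat -> nat -> Prop} :
  wp p m Q ->
  (forall m' o t, exec p m m' o t -> Q m' o t -> Q' m' o t) -> wp p m Q'.
Proof. by move=> [m' [o [t [E q]]]] H; exists m', o, t; split=> //; apply: H. Qed.

Lemma wp_skip m (Q : store -> seq nat -> nat -> Prop) :
  Q m [::] 1 -> wp CSkip m Q.
Proof. by move=> q; exists m, [::], 1; split=> //; constructor. Qed.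

Lemma wp_set b e1 e2 m (Q : store -> seq nat -> nat -> Prop) :
  Q (update m b (eval m e1) (eval m e2)) [::] (ecost e1 + ecost e2).+1 ->
  wp (CSet b e1 e2) m Q.
Proof. by move=> q; do 3 eexists; split; [constructor|]. Qed.

Lemma wp_out e m (Q : store -> seq nat -> nat -> Prop) :
  Q m [:: eval m e] (ecost e).+1 -> wp (COut e) m Q.
Proof. by move=> q; do 3 eexists; split; [constructor|]. Qed.

Lemma wp_seq p1 p2 m Q :
  wp p1 m (fun m1 o1 t1 =>
    wp p2 m1 (fun m2 o2 t2 => Q m2 (o1 ++ o2) (t1 + t2))) ->
  wp (CSeq p1 p2) m Q.
Proof.
move=> [m1 [o1 [t1 [E1 [m2 [o2 [t2 [E2 q]]]]]]]].
by do 3 eexists; split; [apply: ExSeq E1 E2|].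
Qed.

Lemma wp_if e p1 p2 m (Q : store -> seq nat -> nat -> Prop) :
  wp (if eval m e != 0 then p1 else p2) m
     (fun m' o t => Q m' o (ecost e + t).+1) ->
  wp (CIf e p1 p2) m Q.
Proof.
by move=> [m1 [o1 [t1 [E q]]]]; do 3 eexists; split; [apply: ExIf E|].
Qed.

Lemma wp_while0 e p m (Q : store -> seq nat -> nat -> Prop) :
  eval m e = 0 -> Q m [::] (ecost e).+1 -> wp (CWhile e p) m Q.
Proof. by move=> e0 q; do 3 eexists; split; [apply: ExWhileF|]. Qed.

Lemma wp_whileS e p m Q :
  eval m e != 0 ->
  wp p m (fun m1 o1 t1 => wp (CWhile e p) m1
    (fun m2 o2 t2 => Q m2 (o1 ++ o2) (ecost e + t1 + t2).+1)) ->
  wp (CWhile e p) m Q.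
Proof.
move=> e0 [m1 [o1 [t1 [E1 [m2 [o2 [t2 [E2 q]]]]]]]].
by do 3 eexists; split; [apply: ExWhileT e0 E1 E2|].
Qed.

Notation Var b := (EGet b (ECst 0)).
Notation "b ::= e" := (CSet b (ECst 0) e) (at level 60, e at level 59).
Notation "p ;; q" := (CSeq p q) (at level 70, right associativity).

Definition For (v : nat) (lim : expr) (body : cmd) : cmd :=
  v ::= ECst 0 ;; CWhile (ESub lim (Var v)) (body ;; v ::= EAdd (Var v) (ECst 1)).

(** [I i.+1] is required after the counter has been advanced, because the increment ends the round.
    The limit is re-evaluated in every round, which is why the invariant must fix its value. The
    factor [n.+1] covers the failing last test; 15 generously bounds the overhead of test and
    increment. *)
Lemma wp_for {v lim body m Q} (I : nat -> store -> seq nat -> Prop)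
    (c : nat -> nat) (n : nat) :
  ~~ writes body v ->
  I 0 (update m v 0 0) [::] ->
  (forall i m o, i <= n -> I i m o -> eval m lim = n) ->
  (forall i m o, i < n -> m v 0 = i -> I i m o ->
    wp body m (fun m' o' t =>
      I i.+1 (update m' v 0 i.+1) (o ++ o') /\ t <= c i)) ->
  (forall m' o t, I n m' o ->
    t <= n.+1 * (ecost lim + 15) + \sum_(0 <= i < n) c i -> Q m' o t) ->
  wp (For v lim body) m Q.
Proof.
move=> vb I0 Hlim Hbody HQ; apply/wp_seq/wp_set => /=.
pose J i m o t := [/\ I i m o, m v 0 = i &
  t <= i * (ecost lim + 15) + 3 + \sum_(0 <= i' < i) c i'].
suff loop j : forall i m o t, i + j = n -> J i m o t ->
    wp (CWhile (ESub lim (Var v)) (body ;; v ::= EAdd (Var v) (ECst 1))) m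
      (fun m' o' t' => Q m' (o ++ o') (t + t')).
  apply: (loop n 0 _ [::]) => //.
  by split; rewrite ?big_geq // /update !eqxx.
elim: j => [|j IH] i m0 o t.
  rewrite addn0 => -> [In mv tn].
  apply: wp_while0; first by rewrite /= (Hlim n m0 o) // mv subnn.
  rewrite cats0; apply: HQ => //=; move: tn; rewrite mulSn.
  by move: (_ * _) (\sum_(_ <= _ < _) _) => *; lia.
move=> eqn [Ii mv ti]; have ltin : i < n by rewrite -eqn addnS ltnS leq_addr.
apply: wp_whileS; first by rewrite /= (Hlim i m0 o) ?mv -?lt0n ?subn_gt0 // ltnW.
apply: wp_seq; apply: wp_conseq (Hbody _ _ _ ltin mv Ii) _ => m1 o1 t1 E1 [I1 T1].
apply: wp_set => /=; rewrite cats0 (exec_frame E1 vb) mv addn1.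
have := IH i.+1 (update m1 v 0 i.+1) (o ++ o1)
  (t + (ecost lim + 2).+1.+1 + t1 + 6).
case.
- by rewrite addSnnS.
- split=> //; first by rewrite /update !eqxx.
  rewrite big_nat_recr //= mulSn.
  by move: ti; move: (_ * _) (\sum_(_ <= _ < _) _) => *; lia.
move=> m2 [o2 [t2 [E2 q]]]; exists m2, o2, t2; split=> //.
move: q; rewrite catA; congr (Q _ _ _); lia.
Qed.

Arguments wp_for {v lim body m Q} I c n.

Lemma wp_forc {v lim body m Q} (I : nat -> store -> seq nat -> Prop)
    (c n : nat) :
  ~~ writes body v ->
  I 0 (update m v 0 0) [::] ->
  (forall i m o, i <= n -> I i m o -> eval m lim = n) ->
  (forall i m o, i < n -> m v 0 = i -> I i m o ->
    wp body m (fun m' o' t =>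
      I i.+1 (update m' v 0 i.+1) (o ++ o') /\ t <= c)) ->
  (forall m' o t, I n m' o -> t <= n.+1 * (ecost lim + 15 + c) -> Q m' o t) ->
  wp (For v lim body) m Q.
Proof.
move=> vb I0 Hlim Hbody HQ; apply: (wp_for I (fun=> c) n) => // m' o t In Ht.
apply: HQ => //; apply: leq_trans Ht _.
rewrite sum_nat_const_nat subn0 (mulnDr _ (ecost lim + 15)) leq_add2l leq_mul2r.
by rewrite leqnSn orbT.
Qed.

Arguments wp_forc {v lim body m Q} I c n.

(** * Running a program in a sandbox *)

Notation bAddr := 11 (only parsing).
Notation bBank := 12 (only parsing).
Notation bOld := 13 (only parsing).
Notation bLog := 14 (only parsing).
Notation bRes := 15 (only parsing).

(* Bank 3 holds the presentation of the closure system in both programs; it is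
   shared, as there is no time to copy it. *)
Definition ren (b : nat) : nat := if b == 3 then 3 else 40 + b.

Lemma ren_inj : injective ren.
Proof. 
move=> b b'; rewrite /ren.
by have [->|?] := eqVneq b 3; have [->|?] := eqVneq b' 3; lia.
 Qed.

Lemma ren_eqF b c : c < 40 -> c != 3 -> (c == ren b) = false.
Proof. by rewrite /ren; case: (b == 3); lia. Qed.

Fixpoint ren_expr (e : expr) : expr :=
  match e with
  | ECst n => ECst n
  | EGet b e1 => EGet (ren b) (ren_expr e1)
  | EAdd e1 e2 => EAdd (ren_expr e1) (ren_expr e2)
  | ESub e1 e2 => ESub (ren_expr e1) (ren_expr e2)
  end.

Definition view (m : store) : store := fun b a => m (ren b) a.

Lemma eval_ren m e : eval m (ren_expr e) = eval (view m) e.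
Proof. by elim: e => //= [b e -> //|e1 -> e2 -> //|e1 -> e2 ->]. Qed.

Lemma ecost_ren e : ecost (ren_expr e) = ecost e.
Proof. by elim: e => //= [b e -> //|e1 -> e2 -> //|e1 -> e2 ->]. Qed.

Lemma ecost_gt0 e : 0 < ecost e. Proof. by case: e. Qed.

(** An assignment first logs what it is about to overwrite. The log banks lie outside the range of
    [ren], so logging does not disturb the evaluation of renamed expressions. [COut] becomes a store
    to [bRes]: the oracle's answer must not reach the output. *)
Fixpoint sandbox (p : cmd) : cmd :=
  match p with
  | CSkip => CSkip
  | CSet b e1 e2 =>
      CSet bAddr (Var bLog) (ren_expr e1) ;;
      CSet bBank (Var bLog) (ECst b) ;;
      CSet bOld (Var bLog) (EGet (ren b) (ren_expr e1)) ;;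
      bLog ::= EAdd (Var bLog) (ECst 1) ;;
      CSet (ren b) (ren_expr e1) (ren_expr e2)
  | COut e => bRes ::= ren_expr e
  | CSeq p1 p2 => sandbox p1 ;; sandbox p2
  | CIf e p1 p2 => CIf (ren_expr e) (sandbox p1) (sandbox p2)
  | CWhile e p => CWhile (ren_expr e) (sandbox p)
  end.

(** Banks are literals of the program, so a logged bank number cannot select a bank directly;
    [restore] finds it by comparison with this finite list. *)
Fixpoint banks (p : cmd) : seq nat :=
  match p with
  | CSkip | COut _ => [::]
  | CSet b _ _ => [:: b]
  | CSeq p1 p2 | CIf _ p1 p2 => banks p1 ++ banks p2
  | CWhile _ p => banks p
  end.

(* A log entry records the bank, the address and the overwritten value. *)
Definition entry : Type := (nat * nat * nat)%type.

Definition undo_entry (e : entry) (v : store) : store :=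
  update v e.1.1 e.1.2 e.2.

Definition logs (m : store) (L : seq entry) : Prop :=
  m bLog 0 = size L /\
  forall i, i < size L -> nth (0, 0, 0) L i = (m bBank i, m bAddr i, m bOld i).

Lemma view_update_ren m b a x :
  view (update m (ren b) a x) = update (view m) b a x.
Proof.
apply/funext => b'; apply/funext => a'.
by rewrite /view /update (inj_eq ren_inj).
Qed.

Lemma view_update m b a x : b < 40 -> b != 3 -> view (update m b a x) = view m.
Proof.
move=> b40 b3; apply/funext => b'; apply/funext => a'.
by rewrite /view /update eq_sym ren_eqF.
Qed.

Lemma update_undo v b a x : update (update v b a x) b a (v b a) = v.
Proof.
apply/funext => b'; apply/funext => a'; rewrite /update.
by case: andP => // -[/eqP-> /eqP->].
Qed.

Lemma sandbox_set b e1 e2 m L : logs m L ->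
  let v := view m in
  exists m' t', [/\ exec (sandbox (CSet b e1 e2)) m m' [::] t',
    view m' = update v b (eval v e1) (eval v e2), m' bRes 0 = m bRes 0,
    logs m' (rcons L (b, eval v e1, v b (eval v e1))) &
    t' <= 20 * (ecost e1 + ecost e2).+1].
Proof.
move=> [l1 l2] /=.
suff [m' [o [t [E H]]]] : wp (sandbox (CSet b e1 e2)) m (fun m' _ t' =>
     [/\ view m' = update (view m) b (eval (view m) e1) (eval (view m) e2),
    m' bRes 0 = m bRes 0,
    logs m' (rcons L (b, eval (view m) e1, view m b (eval (view m) e1))) &
    t' <= 20 * (ecost e1 + ecost e2).+1]).
  by have o0 := exec_silent E isT; subst o; exists m', t; case: H.
apply/wp_seq/wp_set; apply/wp_seq/wp_set; apply/wp_seq/wp_set.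
apply/wp_seq/wp_set; apply/wp_set.
rewrite /= !eval_ren !view_update_ren !view_update // !ecost_ren.
split=> //.
- by rewrite /update /= !ren_eqF.
- split=> /=; first by rewrite size_rcons /update /= !ren_eqF //= l1 addn1.
  move=> i; rewrite size_rcons ltnS nth_rcons leq_eqVlt.
  rewrite /update /= !ren_eqF //= l1.
  case/orP=> [/eqP-> | ltiL].
    by rewrite ltnn !eqxx ![ren b == _]eq_sym !ren_eqF.
  by rewrite ltiL l2 // (ltn_eqF ltiL).
- by move: (ecost_gt0 e1) (ecost_gt0 e2); lia.
Qed.

(** Simulation, by induction on the execution. [L'] is the part of the log written meanwhile;
    [foldr] undoes the last entry first, so the logs of consecutive pieces simply concatenate.
    [size L' <= t] is what makes undoing as cheap as running. *)
Lemma sandbox_exec p v v' o t : exec p v v' o t ->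
  forall m L, view m = v -> logs m L ->
  exists m' L' t', [/\ exec (sandbox p) m m' [::] t', view m' = v',
    m' bRes 0 = last (m bRes 0) o /\ logs m' (L ++ L'),
    all (fun e => e.1.1 \in banks p) L' /\ foldr undo_entry v' L' = v
    & size L' <= t /\ t' <= 20 * t].
Proof.
elim=> {p v v' o t}.
- move=> v m L vm l; exists m, [::], 1; split=> //=; first by constructor.
  by rewrite cats0.
- move=> v b e1 e2 m L vm /(sandbox_set b e1 e2) [m' [t' [E vm' r l t'le]]].
  exists m', [:: (b, eval v e1, v b (eval v e1))], t'; split=> //.
  + by rewrite vm' vm.
  + by split=> //; rewrite cats1 -vm.
  + by split; rewrite /= ?inE ?eqxx // /undo_entry /= update_undo.
- move=> v e m L vm [l1 l2]; eexists; exists [::]; eexists; split.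
  + exact: ExSet.
  + by rewrite view_update.
  + split; first by rewrite /update /= eval_ren vm.
    by rewrite cats0; split=> //.
  + by split.
  + by split=> //=; rewrite ecost_ren; lia.
- move=> p1 p2 v v1 v2 o1 o2 t1 t2 _ IH1 _ IH2 m L vm l.
  have [m1 [L1 [t1' [E1 vm1 [r1 l1] [b1 u1] [s1 c1]]]]] := IH1 _ _ vm l.
  have [m2 [L2 [t2' [E2 vm2 [r2 l2] [b2 u2] [s2 c2]]]]] := IH2 _ _ vm1 l1.
  exists m2, (L1 ++ L2), (t1' + t2'); split=> //.
  + by rewrite -[[::]]/([::] ++ [::]); apply: ExSeq E1 E2.
  + by rewrite r2 r1 last_cat catA.
  + rewrite foldr_cat u2 u1 all_cat; split=> //; apply/andP; split.
      by apply: sub_all b1 => e; rewrite mem_cat => ->.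
    by apply: sub_all b2 => e; rewrite mem_cat orbC => ->.
  + by rewrite size_cat; split; lia.
- move=> v v' e p1 p2 o t _ IH m L vm l.
  have [m1 [L1 [t1' [E1 vm1 rl1 [b1 u1] [s1 c1]]]]] := IH _ _ vm l.
  exists m1, L1, (ecost e + t1').+1; split=> //.
  + rewrite -(ecost_ren e); apply: ExIf; rewrite eval_ren vm.
    by move: E1; case: ifP.
  + split=> //; apply: sub_all b1 => x; rewrite mem_cat.
    by case: ifP => _ ->; rewrite ?orbT.
  + by split; lia.
- move=> v e p e0 m L vm l; exists m, [::], (ecost e).+1; split=> //.
  + by rewrite -(ecost_ren e); apply: ExWhileF; rewrite eval_ren vm.
  + by rewrite cats0.
  + by split=> //; lia.
- move=> v v1 v2 e p o1 o2 t1 t2 e0 _ IH1 _ IH2 m L vm l.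
  have [m1 [L1 [t1' [E1 vm1 [r1 l1] [b1 u1] [s1 c1]]]]] := IH1 _ _ vm l.
  have [m2 [L2 [t2' [E2 vm2 [r2 l2] [b2 u2] [s2 c2]]]]] := IH2 _ _ vm1 l1.
  exists m2, (L1 ++ L2), (ecost e + t1' + t2').+1; split=> //.
  + rewrite -[[::]]/([::] ++ [::]) -(ecost_ren e).
    by apply: ExWhileT E1 E2; rewrite eval_ren vm.
  + by rewrite r2 r1 last_cat catA.
  + by rewrite foldr_cat u2 u1 all_cat b1.
  + by rewrite size_cat; split; lia.
Qed.

(** The sum of the two truncated subtractions is the distance of the two numbers, thus nonzero
    exactly if they differ. *)
Fixpoint restore (bs : seq nat) : cmd :=
  if bs is b :: bs' then
    CIf (EAdd (ESub (EGet bBank (Var bLog)) (ECst b))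
              (ESub (ECst b) (EGet bBank (Var bLog))))
      (restore bs')
      (CSet (ren b) (EGet bAddr (Var bLog)) (EGet bOld (Var bLog)))
  else CSkip.

Definition undo (bs : seq nat) : cmd :=
  CWhile (Var bLog) (bLog ::= ESub (Var bLog) (ECst 1) ;; restore bs).

Lemma restore_spec (bs : seq nat) m :
  m bBank (m bLog 0) \in bs ->
  wp (restore bs) m (fun m' o t =>
    [/\ m' = update m (ren (m bBank (m bLog 0))) (m bAddr (m bLog 0))
                 (m bOld (m bLog 0)), o = [::] & t <= 20 * (size bs).+1]).
Proof.
elim: bs => //= b bs IH; rewrite inE => bin; apply: wp_if => /=.
set x := m bBank _ in bin *.
have [xb|nxb] := eqVneq x b.
  rewrite xb !subnn /=; apply: wp_set => /=; split=> //; lia.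
rewrite (_ : _ != 0); last by lia.
move: bin; rewrite (negbTE nxb) => /IH H; apply: wp_conseq H _ => m' o t _.
by case=> -> -> ?; split=> //; lia.
Qed.

Lemma undo_spec (bs : seq nat) m L : logs m L -> all (fun e => e.1.1 \in bs) L ->
  wp (undo bs) m (fun m' o t => [/\ view m' = foldr undo_entry (view m) L,
    m' bLog 0 = 0, o = [::] & t <= 40 * (size bs).+1 * (size L).+1]).
Proof.
elim/last_ind: L m => [|L e IH] m [l1 l2] Lb.
  by apply: wp_while0 => //=; split=> //; lia.
move: l1 Lb; rewrite size_rcons all_rcons => l1 /andP[eb Lb].
apply: wp_whileS; first by rewrite /= l1.
apply/wp_seq/wp_set => /=; rewrite l1 subn1 /=.
have := l2 (size L); rewrite size_rcons ltnSn nth_rcons ltnn eqxx => /(_ isT) eE.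
set m1 := update m _ _ _.
have := @restore_spec bs m1; rewrite /m1 /update /= -/m1.
move: eb; rewrite eE /= => eb /(_ eb) H.
apply: wp_conseq H _ => m2 o2 t2 _ [-> -> t2le].
have : logs (update m1 (ren (m 12 (size L))) (m 11 (size L)) (m 13 (size L))) L.
  rewrite /logs /m1 /update /= !ren_eqF //=; split=> // i ltiL.
  rewrite -l2 ?size_rcons; last exact: leqW.
  by rewrite nth_rcons ltiL.
move=> /IH /(_ Lb) {}H; apply: wp_conseq H _ => m3 o3 t3 _ [v3 l3 -> t3le].
split=> //.
- by rewrite v3 view_update_ren view_update // -cats1 foldr_cat /=.
- move: t2le t3le (ltn0Sn (size bs)); move: (size bs).+1 => x.
  by rewrite !(mulnS (40 * x)); move: (40 * x * size L); lia.
Qed.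

Definition call (p : cmd) : cmd := sandbox p ;; undo (banks p).

Lemma silent_sandbox p : silent (sandbox p).
Proof. by elim: p => //= [? -> ? -> //|? ? -> ? -> //]. Qed.

Lemma silent_call p : silent (call p).
Proof.
rewrite /= silent_sandbox /=.
by elim: (banks p) => //= b bs ->.
Qed.

Lemma writes_call p b : b < 40 -> b != 3 ->
  b \notin [:: bAddr; bBank; bOld; bLog; bRes] -> ~~ writes (call p) b.
Proof.
move=> b40 b3; rewrite !inE => bL; rewrite /= !negb_or.
move: bL; rewrite !negb_or => /and5P[n1 n2 n3 n4 n5]; rewrite n4 /=.
apply/andP; split.
  elim: p => //= [b' e1 e2|p1 H1 p2 H2|e p1 H1 p2 H2];
    rewrite !negb_or ?H1 ?H2 ?n1 ?n2 ?n3 ?n4 ?ren_eqF //.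
by elim: (banks p) => //= b' bs H; rewrite negb_or H ren_eqF.
Qed.

(** The log has at most [t] entries, so undoing is linear in [t], with a factor for the fixed number
    of banks. Restoring the view and the log pointer makes the next call possible; log cells beyond
    the pointer may keep garbage. *)
Lemma call_spec p m v b t : exec p (view m) v [:: b] t -> m bLog 0 = 0 ->
  wp (call p) m (fun m' _ t' => [/\ view m' = view m, m' bLog 0 = 0,
    m' bRes 0 = b & t' <= 100 * (size (banks p)).+1 * t.+1]).
Proof.
move=> E m0; have l0 : logs m [::] by [].
have [m1 [L [t1 [E1 vm1 [r1 l1] [b1 u1] [s1 c1]]]]] :=
  sandbox_exec E erefl l0.
apply: wp_seq; exists m1, [::], t1; split=> //.
have := undo_spec l1 b1 => H; apply: wp_conseq H _.
move=> m2 o2 t2 E2 [v2 l2 _ t2le]; split=> //.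
- by rewrite v2 vm1.
- rewrite (exec_frame E2) ?r1 //=.
  by elim: (banks p) => //= ? ? H; rewrite negb_or H ren_eqF.
- move: t2le c1; set x := (size (banks p)).+1.
  have : 40 * x * (size L).+1 <= 40 * x * t.+1 by rewrite leq_mul2l ltnS s1 orbT.
  have : 20 * t <= 20 * x * t.+1.
    by rewrite -mulnA leq_mul2l /=; apply: leq_trans (leq_pmull _ _).
  rewrite -!mulnA; move: (x * _) => *; lia.
Qed.

(** * Depth-first search in a trie *)

Notation bDepth := 4 (only parsing).
Notation bPath := 5 (only parsing).
Notation bMode := 16 (only parsing).
Notation bRun := 17 (only parsing).
Notation bOk := 18 (only parsing).
Notation bHeight := 19 (only parsing).

(* [bMode] is 1 when the node on [bPath] has to be tested, and 0 when the subtree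
   below it is exhausted. *)
Definition dfs_step (test leaf : cmd) : cmd :=
  CIf (Var bMode)
    (test ;;
     CIf (Var bOk)
       (CIf (ESub (Var bHeight) (Var bDepth))
          (CSet bPath (Var bDepth) (ECst 0) ;;
           bDepth ::= EAdd (Var bDepth) (ECst 1))
          (leaf ;; bMode ::= ECst 0))
       (bMode ::= ECst 0))
    (CIf (Var bDepth)
       (CIf (EGet bPath (ESub (Var bDepth) (ECst 1)))
          (bDepth ::= ESub (Var bDepth) (ECst 1))
          (CSet bPath (ESub (Var bDepth) (ECst 1)) (ECst 1) ;;
           bMode ::= ECst 1))
       (bRun ::= ECst 0)).

Definition trie_search (test leaf : cmd) : cmd :=
  bDepth ::= ECst 0 ;; bMode ::= ECst 1 ;; bRun ::= ECst 1 ;;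
  CWhile (Var bRun) (dfs_step test leaf).

(** A subtree is traversed by a segment of rounds of one flat loop, which is not the execution of
    any command. The segment is expressed by continuation: whatever is shown for the loop from [m']
    holds from [m], with [o] and [t] prepended. *)
Definition reach (loop : cmd) (m m' : store) (o : seq nat) (t : nat) : Prop :=
  forall Q, wp loop m' (fun m2 o2 t2 => Q m2 (o ++ o2) (t + t2)) -> wp loop m Q.

Lemma reach_trans loop m m1 m2 o1 o2 t1 t2 :
  reach loop m m1 o1 t1 -> reach loop m1 m2 o2 t2 ->
  reach loop m m2 (o1 ++ o2) (t1 + t2).
Proof.
move=> r1 r2 Q H; apply: r1; apply: r2; apply: wp_conseq H _ => m' o t _.
by rewrite catA addnA.
Qed.

Lemma reach_step e p m m1 o1 t1 : eval m e != 0 -> exec p m m1 o1 t1 ->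
  reach (CWhile e p) m m1 o1 (ecost e + t1).+1.
Proof.
by move=> e0 E Q H; apply: wp_whileS => //; exists m1, o1, t1; split=> //.
Qed.

(** Cells from the depth on are left open; they may hold bits of earlier branches. *)
Definition holds_path (y : seq bool) (m : store) : Prop :=
  m bDepth 0 = size y /\ forall i, i < size y -> m bPath i = nth false y i.

Definition agree_off (m m' : store) : Prop :=
  forall b, b \notin [:: bDepth; bPath; bMode; bRun; bOk] -> m' b =1 m b.

Lemma agree_update b m a x : b \in [:: bDepth; bPath; bMode; bRun; bOk] ->
  agree_off m (update m b a x).
Proof.
by move=> bin b' nb a'; rewrite /update; case: eqP => // bb; rewrite bb bin in nb.
Qed.

Lemma agree_trans m m1 m2 : agree_off m m1 -> agree_off m1 m2 -> agree_off m m2.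
Proof. by move=> h1 h2 b nb a; rewrite h2 ?h1. Qed.

Lemma agree_update2 b b' m a x a' x' :
  b \in [:: bDepth; bPath; bMode; bRun; bOk] ->
  b' \in [:: bDepth; bPath; bMode; bRun; bOk] ->
  agree_off m (update (update m b a x) b' a' x').
Proof.
by move=> bin bin'; apply: (@agree_trans _ (update m b a x)); apply: agree_update.
Qed.

Lemma prefix_rcons_nth (y z : seq bool) b :
  prefix (rcons y b) z = [&& size y < size z, prefix y z &
                           nth false z (size y) == b].
Proof.
rewrite !prefixE size_rcons; have [lt|ge] := ltnP (size y) (size z) => /=.
  by rewrite (take_nth false lt) eqseq_rcons.
apply/negbTE/eqP => /(congr1 size); rewrite size_take size_rcons ltnNge leqW //=.
lia.
Qed.

Section Dfs.

Variables (E : finType) (S : {set E}) (n : nat) (code : E -> seq bool).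
Variables (outp : E -> seq nat) (test leaf : cmd) (a : nat -> nat) (u : nat).
(** Invariants of the client: before the test of a node, after a successful test, and when nothing
    is left to do below the node (also after a failed test). The hypotheses below link them along
    the moves of the search. *)
Variables before visited after : seq bool -> store -> Prop.

Definition below (y : seq bool) : {set E} := [set Z in S | prefix y (code Z)].

Definition viable (y : seq bool) : bool := [exists Z in S, prefix y (code Z)].

(** The search tests only the root, where this is vacuous, and children of viable nodes; the cheap
    tests rely on this promise. *)
Definition parent_viable (y : seq bool) : Prop :=
  forall y' b, y = rcons y' b -> viable y'.

Hypothesis size_code : forall Z, Z \in S -> size (code Z) = n.
Hypothesis code_inj : {in S &, injective code}.
Hypothesis before_agree : forall y m m', agree_off m m' -> before y m -> before y m'.
Hypothesis after_agree : forall y m m', agree_off m m' -> after y m -> after y m'.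
Hypothesis visited_height : forall y m, visited y m -> m bHeight 0 = n.
Hypothesis visited_child : forall y m, size y < n ->
  visited y m -> before (rcons y false) m.
Hypothesis after_sibling : forall y m, size y < n -> viable y ->
  after (rcons y false) m -> before (rcons y true) m.
Hypothesis after_parent : forall y m, size y < n ->
  after (rcons y true) m -> after y m.
Hypothesis test_silent : silent test.
Hypothesis test_writes :
  all (fun b => ~~ writes test b) [:: bDepth; bPath; bMode; bRun].
Hypothesis leaf_writes :
  all (fun b => ~~ writes leaf b) [:: bDepth; bPath; bMode; bRun].
Hypothesis test_spec : forall y m, size y <= n -> parent_viable y ->
  holds_path y m -> before y m ->
  wp test m (fun m' _ t => [/\ m' bOk 0 = viable y,
    if viable y then visited y m' else after y m' & t <= a (size y)]).
Hypothesis leaf_spec : forall Z m, Z \in S -> holds_path (code Z) m ->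
  visited (code Z) m ->
  wp leaf m (fun m' o t => [/\ o = outp Z, after (code Z) m' & t <= u]).

Lemma belowP y : viable y = (below y != set0).
Proof.
apply/existsP/set0Pn => -[Z H]; exists Z; first by rewrite inE.
by rewrite inE in H.
Qed.

Lemma below_split y : size y < n ->
  below y = below (rcons y false) :|: below (rcons y true).
Proof.
move=> yn; apply/setP => Z; rewrite !inE; have [ZS|//] := boolP (Z \in S).
rewrite !prefix_rcons_nth size_code // yn /= -andb_orr.
by case: (nth _ _ _); rewrite /= ?andbT ?orbT.
Qed.

Lemma below_disjoint y : [disjoint below (rcons y false) & below (rcons y true)].
Proof.
rewrite -setI_eq0; apply/eqP/setP => Z; rewrite !inE !prefix_rcons_nth.
by case: (nth _ _ _); rewrite /= ?andbF.
Qed.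

(** The charge to one output for its branch below a node of height [j]: two tests per level, of a
    child and its sibling at depth [n - j'], plus the leaf. The 60 covers the loop steps around a
    test. *)
Fixpoint subtree_cost (j : nat) : nat :=
  if j is j'.+1 then subtree_cost j' + 2 * (a (n - j') + 60) else u + 30.

Let loop := CWhile (Var bRun) (dfs_step test leaf).

Lemma holds_agree y m m' : m' bDepth 0 = m bDepth 0 -> m' bPath =1 m bPath ->
  holds_path y m -> holds_path y m'.
Proof. by move=> e1 e2 [h1 h2]; split=> [|i /h2]; rewrite ?e1 ?e2. Qed.

Lemma dfs_test y m : size y <= n -> parent_viable y ->
  holds_path y m -> before y m -> m bMode 0 = 1 -> m bRun 0 = 1 ->
  wp (dfs_step test leaf) m (fun m' o t => m' bRun 0 = 1 /\
    if ~~ viable y then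
      [/\ holds_path y m', after y m', m' bMode 0 = 0, o = [::]
        & t <= a (size y) + 25]
    else if size y < n then
      [/\ holds_path (rcons y false) m', before (rcons y false) m', m' bMode 0 = 1,
        o = [::] & t <= a (size y) + 25]
    else exists2 Z, Z \in S /\ y = code Z &
      [/\ holds_path y m', after y m', m' bMode 0 = 0, o = outp Z
        & t <= a (size y) + u + 25]).
Proof.
move=> ly py hy Ky mode run.
apply: wp_if; rewrite /= mode /=; apply: wp_seq.
apply: wp_conseq (test_spec ly py hy Ky) _ => m1 o1 t1 E1 [ok1 JL1 t1le].
have -> := exec_silent E1 test_silent.
have /and5P[w1 w2 w3 w4 _] := test_writes.
have run1 : m1 bRun 0 = 1 by rewrite (exec_frame E1).
have mode1 : m1 bMode 0 = 1 by rewrite (exec_frame E1).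
have hy1 : holds_path y m1 by apply: holds_agree hy; [|move=> ?];
  rewrite (exec_frame E1).
apply: wp_if; rewrite /= ok1; have [vy|nvy] /= := boolP (viable y); last first.
  apply: wp_set; rewrite (negbTE nvy) in JL1; split=> //.
  split=> //=; last by move: t1le; clear; lia.
  by apply: after_agree JL1; apply: agree_update.
rewrite vy in JL1; apply: wp_if; rewrite /= (visited_height JL1) (proj1 hy1).
have [ltyn|geyn] := ltnP (size y) n.
  rewrite -lt0n subn_gt0 ltyn; apply/wp_seq/wp_set/wp_set => /=.
  split=> //; split=> //=; last by move: t1le; clear; lia.
  + case: hy1 => h1 h2; split; rewrite size_rcons /update /= h1 ?addn1 //.
    move=> i; rewrite ltnS leq_eqVlt nth_rcons => /orP[/eqP->|lti].
      by rewrite eqxx ltnn.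
    by rewrite (ltn_eqF lti) lti h2.
  + apply: (@before_agree _ m1); last exact: visited_child.
    exact: agree_update2.
move: (geyn); rewrite -subn_eq0 => /eqP -> /=.
have [Z ZS yZ] : exists2 Z, Z \in S & y = code Z.
  case/existsP: vy => Z /andP[ZS]; rewrite prefixE => /eqP yZ; exists Z => //.
  by rewrite -yZ take_oversize // size_code.
apply: wp_seq; rewrite yZ in hy1 JL1.
apply: wp_conseq (leaf_spec ZS hy1 JL1) _ => m2 o2 t2 E2 [-> L2 t2le].
have /and5P[v1 v2 v3 v4 _] := leaf_writes.
apply: wp_set; split=> /=; first by rewrite /update /= (exec_frame E2).
exists Z => //; rewrite yZ; split=> //=;
  last by rewrite -yZ; move: t1le t2le; clear; lia.
- apply: (@holds_agree _ m1) => // [|i]; rewrite /update /= (exec_frame E2) //.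
- by apply: after_agree L2; apply: agree_update.
- by rewrite cats0.
Qed.

Lemma dfs_sibling y m : size y < n -> viable y ->
  holds_path (rcons y false) m -> after (rcons y false) m ->
  m bMode 0 = 0 -> m bRun 0 = 1 ->
  wp (dfs_step test leaf) m (fun m' o t =>
    [/\ holds_path (rcons y true) m', before (rcons y true) m',
      m' bMode 0 = 1 /\ m' bRun 0 = 1, o = [::] & t <= 25]).
Proof.
move=> yn vy [h1 h2] Ly mode run; rewrite size_rcons in h1 h2.
apply: wp_if; rewrite /= mode /=; apply: wp_if; rewrite /= h1 /=.
apply: wp_if; rewrite /= h1 subn1 /= h2 // nth_rcons ltnn eqxx /=.
apply/wp_seq/wp_set/wp_set => /=; rewrite h1 subn1 /=; split=> //.
- split; rewrite size_rcons /update //=.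
  move=> i ltiy; rewrite h2 // !nth_rcons.
  move: ltiy; rewrite ltnS leq_eqVlt => /orP[/eqP->|lti].
    by rewrite ltnn eqxx.
  by rewrite lti (ltn_eqF lti).
- apply: (@before_agree _ m); last exact: after_sibling.
  exact: agree_update2.
Qed.

Lemma dfs_up y m : size y < n ->
  holds_path (rcons y true) m -> after (rcons y true) m ->
  m bMode 0 = 0 -> m bRun 0 = 1 ->
  wp (dfs_step test leaf) m (fun m' o t =>
    [/\ holds_path y m', after y m',
      m' bMode 0 = 0 /\ m' bRun 0 = 1, o = [::] & t <= 25]).
Proof.
move=> yn [h1 h2] Ly mode run; rewrite size_rcons in h1 h2.
apply: wp_if; rewrite /= mode /=; apply: wp_if; rewrite /= h1 /=.
apply: wp_if; rewrite /= h1 subn1 /= h2 // nth_rcons ltnn eqxx /=.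
apply/wp_set => /=; rewrite h1 subn1 /=; split=> //.
- split; rewrite /update //= => i ltiy.
  by rewrite h2 ?nth_rcons ?ltiy // ltnW.
- apply: (@after_agree _ m); last exact: after_parent.
  exact: agree_update.
Qed.

(** Induction on the height. The test of [y] itself stays outside the charge per output, since [y]
    may have no output below it; its parent, being viable, has one that can pay. *)
Lemma dfs_subtree j y m : size y + j = n -> parent_viable y ->
  holds_path y m -> before y m -> m bMode 0 = 1 -> m bRun 0 = 1 ->
  exists m' l t, [/\ reach loop m m' (flatten (map outp l)) t,
    holds_path y m' /\ after y m', m' bMode 0 = 0 /\ m' bRun 0 = 1,
    uniq l /\ l =i below y
    & t <= a (size y) + 30 + size l * subtree_cost j].
Proof.
elim: j y m => [|j IH] y m szy py hy Ky mode run;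
  have ly : size y <= n by rewrite -szy leq_addr.
  have [m1 [o1 [t1 [E1 []]]]] := dfs_test ly py hy Ky mode run.
  have R1 : eval m (Var bRun) != 0 by rewrite /= run.
  have {}E1 := reach_step R1 E1 => run1.
  case: ifPn => [nvy [hy1 L1 mode1 o1E t1le]|].
    exists m1, [::], (2 + t1).+1; split=> //=;
      [by rewrite -o1E| |move: t1le; clear; lia].
    split=> // Z; rewrite in_nil; move: nvy; rewrite belowP negbK => /eqP->.
    by rewrite inE.
  move=> _; rewrite -[in size y < n]szy addn0 ltnn.
  case=> Z [ZS yZ] [hy1 L1 mode1 o1E t1le].
  exists m1, [:: Z], (2 + t1).+1; split=> //=;
      [by rewrite cats0 -o1E| |move: t1le; clear; lia].
  (* A prefix of full length is the whole code, so injectivity leaves a single member. *)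
  split=> // Z'; rewrite !inE; apply/eqP/andP => [->|[Z'S]].
    by rewrite yZ prefix_refl.
  rewrite yZ prefixE size_code // -(size_code Z'S) take_size => /eqP.
  exact: code_inj.
have [m1 [o1 [t1 [E1 []]]]] := dfs_test ly py hy Ky mode run.
have R1 : eval m (Var bRun) != 0 by rewrite /= run.
have {}E1 := reach_step R1 E1 => run1.
case: ifPn => [nvy [hy1 L1 mode1 o1E t1le]|].
  exists m1, [::], (2 + t1).+1; split=> //=;
      [by rewrite -o1E| |move: t1le; clear; lia].
  split=> // Z; rewrite in_nil; move: nvy; rewrite belowP negbK => /eqP->.
  by rewrite inE.
rewrite negbK => vy; have ltyn : size y < n by rewrite -szy -addSnnS leq_addr.
rewrite ltyn => -[hy1 K1 mode1 o1E t1le].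
have szc b : size (rcons y b) + j = n by rewrite size_rcons addSnnS.
have pvc b : parent_viable (rcons y b).
  by move=> y' b' /rcons_inj[<- _].
have [m2 [l2 [t2 [E2 [hy2 L2] [mode2 run2] [u2 d2] t2le]]]] :=
  IH _ _ (szc _) (pvc _) hy1 K1 mode1 run1.
have [m3 [o3 [t3 [E3 [hy3 K3 [mode3 run3] o3E t3le]]]]] :=
  dfs_sibling ltyn vy hy2 L2 mode2 run2.
have R2 : eval m2 (Var bRun) != 0 by rewrite /= run2.
have {}E3 := reach_step R2 E3.
have [m4 [l4 [t4 [E4 [hy4 L4] [mode4 run4] [u4 d4] t4le]]]] :=
  IH _ _ (szc _) (pvc _) hy3 K3 mode3 run3.
have [m5 [o5 [t5 [E5 [hy5 L5 [mode5 run5] o5E t5le]]]]] :=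
  dfs_up ltyn hy4 L4 mode4 run4.
have R4 : eval m4 (Var bRun) != 0 by rewrite /= run4.
have {}E5 := reach_step R4 E5.
have E12 := reach_trans E1 E2.
have E13 := reach_trans E12 E3.
have E14 := reach_trans E13 E4.
have {E1 E2 E3 E4 E5 E12 E13} Er := reach_trans E14 E5.
have dl : l2 ++ l4 =i below y.
  by move=> Z; rewrite mem_cat below_split // d2 d4 in_setU.
have ul : uniq (l2 ++ l4).
  rewrite cat_uniq u2 u4 andbT; apply/hasPn => Z; rewrite d4 => Z4.
  rewrite d2; apply/negP => Z2; have /pred0P/(_ Z) := below_disjoint y.
  by rewrite /= Z2 Z4.
move: Er; rewrite o1E o3E o5E /= !cats0 => Er.
exists m5, (l2 ++ l4); eexists; split.
- by rewrite map_cat flatten_cat; exact: Er.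
- by [].
- by [].
- by [].
(* Viability yields at least one output, and this one takes the tests of both children. *)
- have sz0 : 0 < size (l2 ++ l4).
    case: (l2 ++ l4) dl => // dl; move: vy; rewrite belowP => /set0Pn[Z].
    by rewrite -dl.
  move: t2le t4le sz0; rewrite !size_rcons /= size_cat.
  have -> : n - j = (size y).+1 by rewrite -szy -addSnnS addnK.
  move: (a (size y).+1) t1le t3le t5le => a1.
  move: (size l2) (size l4) (subtree_cost j) => s2 s4 r t1le t3le t5le t2le t4le sz0.
  have : (s2 + s4) * (r + 2 * (a1 + 60)) >= s2 * r + s4 * r + 2 * (a1 + 60).
    by rewrite (mulnDr (s2 + s4)) mulnDl leq_add2l leq_pmull.
  move: t1le t3le t5le t2le t4le; clear; lia.
Qed.

Lemma trie_search_spec m : (forall m', agree_off m m' -> before [::] m') ->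
  wp (trie_search test leaf) m (fun m' o t => exists l,
    [/\ uniq l, l =i S, o = flatten (map outp l)
      & t <= a 0 + 100 + size l * subtree_cost n]).
Proof.
move=> Km; apply/wp_seq/wp_set/wp_seq/wp_set/wp_seq/wp_set => /=.
set m1 := update _ bRun _ _.
have [|||||m2 [l [t [Er [h2 L2] [mode2 run2] [ul dl] tle]]]] :=
  @dfs_subtree n [::] m1 (erefl n).
- by case.
- by split.
- apply: Km; apply: (@agree_trans _ (update m bDepth 0 0)).
    exact: agree_update.
  exact: agree_update2.
- by [].
- by [].
apply: Er; apply: wp_whileS; first by rewrite /= run2.
apply: wp_if; rewrite /= mode2 /=; apply: wp_if; rewrite /= (proj1 h2) /=.
apply: wp_set; apply: wp_while0 => //=; exists l; split=> //.
- by move=> Z; rewrite dl inE prefix0s andbT.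
- by rewrite !cats0.
- by move: tle => /=; clear; lia.
Qed.

End Dfs.

(** * Codes of closed sets *)

Lemma card_subset_exists (T : finType) (A : {set T}) n :
  n <= #|A| -> exists2 B : {set T}, B \subset A & #|B| = n.
Proof.
move=> nA; have : 0 < 'C(#|A|, n) by rewrite bin_gt0.
rewrite -cards_draws card_gt0 => /set0Pn[B]; rewrite inE => /andP[BA /eqP].
by exists B.
Qed.

Lemma card_disjointU (T : finType) (A B : {set T}) :
  [disjoint A & B] -> #|A :|: B| = #|A| + #|B|.
Proof. by move=> dAB; apply/eqP; rewrite (leq_card_setU A B).2. Qed.

Section Codes.

Variables (w : nat) (Sigma : seq (implication 'I_w)) (k : nat).
Implicit Types (X Y Z : {set 'I_w}) (y : seq bool) (q : 'I_w).

Definition premises : {set 'I_w} := \bigcup_(r <- Sigma) r.1.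

Definition cl X : {set 'I_w} := \bigcap_(Z in Mod Sigma | X \subset Z) Z.

Lemma Mod_rule Z r : Z \in Mod Sigma -> r \in Sigma -> r.1 \subset Z ->
  r.2 \subset Z.
Proof. by rewrite inE => /allP H /H /implyP. Qed.

Lemma sub_cl X : X \subset cl X.
Proof. by apply/bigcapsP => Z /andP[]. Qed.

Lemma cl_min X Z : Z \in Mod Sigma -> X \subset Z -> cl X \subset Z.
Proof. by move=> ZM XZ; apply: (bigcap_inf Z); rewrite ZM XZ. Qed.

Lemma cl_Mod X : cl X \in Mod Sigma.
Proof.
rewrite inE; apply/allP => r rS; apply/implyP => r1; apply/bigcapsP => Z.
case/andP=> ZM XZ; apply: (Mod_rule ZM rS); apply: subset_trans r1 _.
exact: cl_min.
Qed.

Lemma premise_sub r : r \in Sigma -> r.1 \subset premises.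
Proof. by move=> rS; rewrite /premises (big_rem r) //= subsetUl. Qed.

(** A premise contained in [Z] lies in the trace of [Z] on [premises] (the set D), so its conclusion
    lies in the closure of that trace. Consequently elements outside [premises] may be added to a
    closed set at will. *)
Lemma Mod_trace Z : cl (Z :&: premises) \subset Z -> Z \in Mod Sigma.
Proof.
move=> clZ; rewrite inE; apply/allP => r rS; apply/implyP => r1.
apply: subset_trans clZ; apply: (Mod_rule (cl_Mod _) rS).
apply: subset_trans (sub_cl _); rewrite subsetI r1; exact: premise_sub.
Qed.

Definition bits X : seq bool := [seq i \in X | i <- enum 'I_w].

Lemma size_bits X : size (bits X) = w.
Proof. by rewrite size_map size_enum_ord. Qed.

Lemma nth_bits X q : nth false (bits X) q = (q \in X).
Proof. by rewrite (nth_map q) ?size_enum_ord // nth_ord_enum. Qed.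

(** The second half has 0 at every element whose membership the first half already settles, so that
    only genuinely free choices branch there. *)
Definition code Z : seq bool :=
  bits (Z :&: premises) ++ bits (Z :\: (premises :|: cl (Z :&: premises))).

Definition ones y : {set 'I_w} := [set q in premises | nth false y q].

(** The guard on the size is essential: past the end of [y] the default bit would read an undecided
    element as refused. In [ones] the same default is harmless. *)
Definition zeros y : {set 'I_w} :=
  [set q in premises | (q < size y) && ~~ nth false y q].

Definition free_elts y : {set 'I_w} := ~: (premises :|: cl (ones y)).

(** The cut [j] is separate from the length of [y], so that the counts at all ancestors of [y] can
    be stated in terms of [y] alone. *)
Definition chosen j y : {set 'I_w} :=
  [set q : 'I_w | (w + q < j) && nth false y (w + q)].

Definition undecided j y : {set 'I_w} := [set q in free_elts y | j <= w + q].

Lemma size_code Z : size (code Z) = w + w.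
Proof. by rewrite size_cat !size_bits. Qed.

Lemma nth_code_lo Z q : nth false (code Z) q = (q \in Z :&: premises).
Proof. by rewrite nth_cat size_bits ltn_ord nth_bits. Qed.

Lemma nth_code_hi Z q : nth false (code Z) (w + q) =
  (q \in Z :\: (premises :|: cl (Z :&: premises))).
Proof. by rewrite nth_cat size_bits ltnNge leq_addr /= addKn nth_bits. Qed.

Lemma prefix_nthP (y z : seq bool) :
  reflect (size y <= size z /\ forall j, j < size y -> nth false y j = nth false z j)
          (prefix y z).
Proof.
rewrite prefixE; apply: (iffP eqP) => [yz | [lyz H]].
  split; first by rewrite -yz size_take; case: ltnP => // /ltnW.
  by move=> j lj; rewrite -yz nth_take.
apply: (@eq_from_nth _ false); first by rewrite size_takel.
by move=> j; rewrite size_takel // => lj; rewrite nth_take // H.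
Qed.

Local Notation S := (members_of_size (Mod Sigma) k).
Lemma memS Z : (Z \in S) = (Z \in Mod Sigma) && (#|Z| == k).
Proof. by rewrite [LHS]inE. Qed.

Local Notation viable := (viable S code).

Lemma cl_trace Z : Z \in Mod Sigma -> cl (Z :&: premises) \subset Z.
Proof. by move=> ZM; apply: cl_min => //; apply: subsetIl. Qed.

Lemma ones_prefix Z y : w <= size y -> prefix y (code Z) ->
  ones y = Z :&: premises.
Proof.
move=> wy /prefix_nthP[_ H]; apply/setP => q; rewrite inE H.
  by rewrite nth_code_lo inE andbC -andbA andbb.
exact: leq_trans wy.
Qed.

Lemma ones_rcons y b : ~~ (b && (size y < w)) -> ones (rcons y b) = ones y.
Proof.
move=> nb; apply/setP => q; rewrite !inE nth_rcons.
have [//|gt|eq] := ltngtP q (size y); first by rewrite nth_default // ltnW.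
rewrite eq nth_default //; move: nb; rewrite -eq ltn_ord andbT.
by case: b.
Qed.

(** The two summands are never both 1, as the second half omits the closure. Their sum is what
    [leaf] prints, and it recovers [Z] from its code. Adding 0 makes the left side a number. *)
Lemma mem_code Z q : Z \in Mod Sigma ->
  (q \in Z) + 0 = (q \in cl (ones (code Z))) + nth false (code Z) (w + q).
Proof.
move=> ZM; rewrite (@ones_prefix Z) ?size_code ?leq_addr ?prefix_refl //.
rewrite nth_code_hi !inE; have /subsetP/(_ q) := cl_trace ZM.
have /subsetP/(_ q) := sub_cl (Z :&: premises); rewrite !inE.
case: (q \in Z); case: (q \in premises); case: (q \in cl _) => //=.
  by move=> /(_ isT).
  by move=> _ /(_ isT).
  by move=> _ /(_ isT).
Qed.

Lemma code_inj : {in S &, injective code}.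
Proof.
move=> Z1 Z2; rewrite !memS => /andP[M1 _] /andP[M2 _] e; apply/setP => q.
have := mem_code q M1; rewrite e -(mem_code q M2) !addn0.
by do 2 case: (q \in _).
Qed.

(** A closed set contains [ones y] exactly if it contains the closure. The last hypothesis excludes
    a 1 at an element outside [premises], where every code has 0. *)
Lemma prefix_lo y Z : size y <= w -> Z \in Mod Sigma ->
  (forall q, q < size y -> q \notin premises -> nth false y q = false) ->
  prefix y (code Z) = (cl (ones y) \subset Z) && (zeros y :&: Z == set0).
Proof.
move=> yw ZM skip; apply/prefix_nthP/andP => [[_ H]|[/subsetP clZ /eqP/setP zZ]].
  split.
    apply: cl_min => //; apply/subsetP => q; rewrite inE => /andP[qp yq].
    have lq : q < size y.
      by rewrite ltnNge; apply: contraL yq => ?; rewrite nth_default.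
    by move: yq; rewrite H // nth_code_lo inE => /andP[].
  apply/eqP/setP => q; rewrite !inE; apply/negP => -[/andP[/and3P[qp lq]]].
  by rewrite H // nth_code_lo inE qp andbT => /negP.
rewrite size_code; split=> [|j lj]; first by rewrite (leq_trans yw) // leq_addr.
have jw : j < w by apply: leq_trans lj yw.
have := nth_code_lo Z (Ordinal jw) => /= ->; rewrite inE.
have [jp|jp] := boolP (Ordinal jw \in premises); last first.
  by rewrite andbF; apply: (skip (Ordinal jw)).
rewrite andbT; have := zZ (Ordinal jw); rewrite !inE jp lj /=.
have := clZ (Ordinal jw); have /subsetP/(_ (Ordinal jw)) := sub_cl (ones y).
rewrite inE jp /=; case: (nth _ _ _) => [/(_ isT) h /(_ h) -> //|_ _ /=].
by case: (_ \in Z).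
Qed.

(** The parent is a prefix of a code, so its bits outside [premises] are 0, and the last bit belongs
    to an element of [premises]. Hence [prefix_lo] applies, and the closed k-sets below [y] are
    exactly those that the oracle looks for. *)
Lemma viable_full y : size y <= w ->
  (forall y' b, y = rcons y' b ->
     viable y' /\ exists2 q, q \in premises & size y' = q) ->
  viable y = has_disjoint_extension (Mod Sigma) (cl (ones y)) (zeros y) k.
Proof.
move=> yw py.
have skip q : q < size y -> q \notin premises -> nth false y q = false.
  case/lastP: y yw py => // y b; rewrite size_rcons => yw /(_ _ _ erefl).
  case=> /existsP[Z /andP[_ /prefix_nthP[_ H]]] [q' q'p sz].
  rewrite ltnS leq_eqVlt nth_rcons => /orP[/eqP e|lt] qp.
    by move: qp; rewrite (_ : q = q') ?q'p //; apply/val_inj; rewrite /= e.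
  by rewrite lt H // nth_code_lo inE (negbTE qp) andbF.
rewrite /has_disjoint_extension; apply: eq_existsb => Z.
rewrite memS; have [ZM|//] := boolP (Z \in Mod Sigma).
by rewrite prefix_lo //= andbCA.
Qed.

Lemma viable_skip y b q : viable y -> size y = q -> q \notin premises ->
  viable (rcons y b) = ~~ b.
Proof.
move=> /existsP[Z /andP[ZS pZ]] sz qp.
have bit Z' : nth false (code Z') (size y) = false.
  by rewrite sz nth_code_lo inE (negbTE qp) andbF.
have lt Z' : size y < size (code Z').
  by rewrite size_code sz (leq_trans (ltn_ord q)) // leq_addr.
case: b; last by apply/existsP; exists Z; rewrite ZS prefix_rcons_nth lt pZ bit.
apply/negbTE/negP => /existsP[Z' /andP[_]].
by rewrite prefix_rcons_nth bit !andbF.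
Qed.

Lemma chosen_rcons y b q : size y = w + q ->
  chosen (w + q.+1) (rcons y b) =
  (if b then [set q] else set0) :|: chosen (w + q) y.
Proof.
move=> sz; apply/setP => q'; rewrite !inE nth_rcons sz !ltn_add2l ltnS eqn_add2l.
have [lt|gt|eq] := ltngtP q' q => /=.
- by case: b; rewrite ?inE ?orbF // -val_eqE /= (ltn_eqF lt).
- by case: b; rewrite ?inE ?orbF // -val_eqE /= (gtn_eqF gt).
- by case: b; rewrite ?inE -?val_eqE /= ?eq ?eqxx.
Qed.

Lemma undecided_step y q :
  #|undecided (w + q) y| = (q \in free_elts y) + #|undecided (w + q.+1) y|.
Proof.
rewrite (cardsD1 q) !inE leqnn andbT; congr (_ + _); apply: eq_card => q'.
by rewrite [LHS]inE in_set1 ![_ \in undecided _ _]inE !leq_add2l ltn_neqAle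
  andbCA -val_eqE /= [_ == q :> nat]eq_sym.
Qed.

(** The first condition says that only a free element can be added. Granted this, the closed sets
    below [rcons y b] are the closure, the chosen elements and an arbitrary part of the undecided
    ones, by [Mod_trace]; the three are disjoint, so every cardinality between the extremes occurs.
    Viability of [y] supplies a closed [Z0] with trace [ones y]. *)
Lemma viable_free y b q : viable y -> size y = w + q ->
  viable (rcons y b) =
  [&& b <= (q \in free_elts y),
      #|cl (ones y)| + #|chosen (w + q.+1) (rcons y b)| <= k &
      k <= #|cl (ones y)| + #|chosen (w + q.+1) (rcons y b)|
           + #|undecided (w + q.+1) y|].
Proof.
move=> /existsP[Z0 /andP[Z0S pZ0]] sz.
have wy : w <= size y by rewrite sz leq_addr.
have := ones_prefix wy pZ0 => oy0.
have TE : (b <= (q \in free_elts y)) ->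
    chosen (w + q.+1) (rcons y b) \subset free_elts y.
  move=> bf; rewrite chosen_rcons // subUset; apply/andP; split.
    by case: b bf; rewrite ?sub0set // sub1set; case: (q \in _).
  apply/subsetP => q'; rewrite inE => /andP[lt].
  have /prefix_nthP[_ H] := pZ0.
  by rewrite H ?sz // nth_code_hi -oy0 !inE => /andP[].
set T := chosen _ _ in TE *; set R := undecided _ y; set U := cl _.
have TR : [disjoint T & R].
  rewrite -setI_eq0; apply/eqP/setP => q'; rewrite !inE.
  by rewrite ltnNge; case: (_ <= w + q'); rewrite /= ?andbF.
have UT : T \subset free_elts y -> [disjoint U & T :|: R].
  move=> Tf; rewrite disjoint_sym; have TRf : T :|: R \subset free_elts y.
    by rewrite subUset Tf; apply/subsetP => q'; rewrite inE => /andP[].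
  apply: disjointWl TRf _; rewrite -setI_eq0; apply/eqP/setP => q'.
  by rewrite !inE -/U; case: (q' \in U); rewrite ?orbT ?andbF.
apply/existsP/and3P => [[Z /andP[ZS pZ]]|[bf Tk kR]].
  have oy : ones y = Z :&: premises.
    rewrite -(@ones_rcons y b) ?ltnNge ?wy ?andbF //.
    by rewrite (@ones_prefix Z) // size_rcons leqW.
  move: ZS; rewrite memS => /andP[ZM /eqP cZ].
  have UZ : U \subset Z by rewrite /U oy cl_trace.
  have /prefix_nthP[_ H] := pZ.
  have bf : b <= (q \in free_elts y).
    have := H (size y); rewrite size_rcons ltnSn nth_rcons ltnn eqxx => /(_ isT) ->.
    by rewrite sz nth_code_hi -oy !inE; case: (~~ _); rewrite ?leq_b1.
  have lts q' : w + q' < w + q.+1 -> w + q' < size (rcons y b).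
    by rewrite size_rcons sz addnS.
  have TZ : T \subset Z.
    apply/subsetP => q'; rewrite inE => /andP[lt].
    rewrite H ?lts // nth_code_hi !inE.
    by case/andP.
  have cUT : #|U :|: T| = #|U| + #|T|.
    rewrite card_disjointU //; apply: (disjointWr _ (UT (TE bf))).
    exact: subsetUl.
  have cUTR : #|U :|: (T :|: R)| = #|U| + #|T| + #|R|.
    by rewrite card_disjointU ?UT ?TE // card_disjointU // addnA.
  split=> //; first by rewrite -cUT -cZ subset_leq_card // subUset UZ.
  rewrite -cUTR -cZ subset_leq_card //; apply/subsetP => q' q'Z.
  rewrite in_setU; have [//|q'U /=] := boolP (q' \in U).
  have q'p : q' \notin premises.
    apply: contra q'U => q'p; apply: (subsetP (sub_cl _)).
    by rewrite oy inE q'Z.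
  rewrite in_setU; have [lt|ge] := ltnP (w + q') (w + q.+1).
    apply/orP; left; rewrite inE lt H ?lts // nth_code_hi !inE -oy -/U q'Z.
    by rewrite (negbTE q'p) (negbTE q'U).
  apply/orP; right; rewrite !inE ge -/U (negbTE q'p) (negbTE q'U).
  by [].
have Tf := TE bf; have dU := UT Tf.
(* Undecided elements fill the set up to exactly k. *)
have [R' R'R cR'] := @card_subset_exists _ R (k - (#|U| + #|T|)) ltac:(lia).
have UZ0 : U \subset Z0.
  by rewrite /U oy0 cl_trace //; move: Z0S; rewrite memS => /andP[].
have TRf : T :|: R' \subset free_elts y.
  rewrite subUset Tf; apply: subset_trans R'R _.
  by apply/subsetP => q'; rewrite inE => /andP[].
pose Z := U :|: (T :|: R').
(* The closure brings in no further element of [premises], because it lies in [Z0], whose trace is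
   [ones y]. *)
have Zp : Z :&: premises = ones y.
  apply/setP => q'; rewrite in_setI in_setU; apply/andP/idP => [[]|qo].
    case/orP => [/(subsetP UZ0) qZ0 qp|/(subsetP TRf)]; first by rewrite oy0 inE qZ0.
    by rewrite !inE => /norP[/negbTE->].
  rewrite (subsetP (sub_cl _) _ qo); split=> //.
  by move: qo; rewrite inE => /andP[].
exists Z; rewrite memS Mod_trace ?Zp ?subsetUl //=; apply/andP; split.
  rewrite card_disjointU; last by apply: (disjointWr _ dU); apply: setUS.
  rewrite card_disjointU; last by apply: (disjointWr R'R).
  by rewrite cR' addnA subnKC.
apply/prefix_nthP; rewrite size_rcons size_code sz -addnS leq_add2l ltn_ord.
split=> // j ltj; have [jw|wj] := ltnP j w.
  have := nth_code_lo Z (Ordinal jw) => /= ->; rewrite Zp oy0 -nth_code_lo /=.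
  have /prefix_nthP[_ <-] := pZ0; last exact: leq_trans jw wy.
  by rewrite nth_rcons (leq_trans jw wy).
have jw : j - w < w by rewrite ltn_subLR // (leq_trans ltj) // leq_add2l ltn_ord.
rewrite -(subnKC wj) in ltj *; have := nth_code_hi Z (Ordinal jw) => /= ->.
rewrite Zp in_setD; set q' := Ordinal jw.
have -> : nth false (rcons y b) (w + (j - w)) = (q' \in T) by rewrite inE ltj.
have [q'T|q'T] := boolP (q' \in T).
  have := subsetP Tf _ q'T; rewrite in_setC => -> /=.
  by rewrite !in_setU q'T orbT.
rewrite !in_setU (negbTE q'T) /=; have -> : (q' \in R') = false.
  apply/negbTE/negP => /(subsetP R'R); rewrite inE => /andP[_].
  by rewrite leqNgt ltj.
by rewrite orbF -/U; case: (q' \in U); rewrite ?orbT ?andbF.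
Qed.

End Codes.

(** * Linear-time closure *)

(* Cell [q.+1] tells whether [q] belongs to a premise; cell 0 is set, so that the
   root of the trie gets an expensive test. *)
Notation bPrem := 6 (only parsing).
Notation bMin := 7 (only parsing).
Notation bMax := 8 (only parsing).
Notation bStack := 9 (only parsing).
Notation bCount := 10 (only parsing).
Notation bQ := 20 (only parsing).
Notation bJ := 21 (only parsing).
Notation bRow := 22 (only parsing).
Notation bPop := 23 (only parsing).
Notation bTop := 24 (only parsing).
Notation bI := 25 (only parsing).
Notation bCl := 41 (only parsing).
Notation bZero := 42 (only parsing).

Notation eW := (EGet 0 (ECst 0)).
Notation eK := (EGet 0 (ECst 1)).
Notation eH := (EGet 0 (ECst 2)).
Notation eS := (EGet 0 (ECst 3)).

Definition push (v : nat) : cmd :=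
  CSet bCl (Var v) (ECst 1) ;;
  CSet bStack (Var bTop) (Var v) ;;
  bTop ::= EAdd (Var bTop) (ECst 1).

(** The difference of the bits is nonzero exactly for an element of the conclusion that is not yet
    in the set, so nothing is stacked twice. *)
Definition fire : cmd :=
  For bI eW
    (CIf (ESub (EGet 2 (EAdd (Var bRow) (Var bI))) (EGet bCl (Var bI)))
       (push bI) CSkip).

(** A counter holds the number of premise elements not yet processed; empty premises fire at once.
    [bRow] steps through the row offsets by addition, as the machine has no multiplication. *)
Definition init_counts : cmd :=
  bRow ::= ECst 0 ;;
  For bJ eH
    (CSet bCount (Var bJ) (ECst 0) ;;
     For bQ eW
       (CSet bCount (Var bJ)
          (EAdd (EGet bCount (Var bJ)) (EGet 1 (EAdd (Var bRow) (Var bQ))))) ;;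
     CIf (EGet bCount (Var bJ)) CSkip fire ;;
     bRow ::= EAdd (Var bRow) eW).

Definition process : cmd :=
  For bJ eH
    (CIf (EGet 1 (EAdd (Var bRow) (Var bPop)))
       (CSet bCount (Var bJ) (ESub (EGet bCount (Var bJ)) (ECst 1)) ;;
        CIf (EGet bCount (Var bJ)) CSkip fire)
       CSkip ;;
     bRow ::= EAdd (Var bRow) eW).

(** The counter method known as LinClosure. No occurrence lists are built: scanning all h rows for
    each processed element stays within O(hw). *)
Definition drain : cmd :=
  CWhile (Var bTop)
    (bTop ::= ESub (Var bTop) (ECst 1) ;;
     bPop ::= EGet bStack (Var bTop) ;;
     bRow ::= ECst 0 ;;
     process).

(** * Characteristic vectors as memory contents *)

Lemma nth_chi w (X : {set 'I_w}) (q : 'I_w) : nth 0 (chi X) q = (q \in X).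
Proof. by rewrite (nth_map q) ?size_enum_ord // nth_ord_enum. Qed.

Lemma size_chi w (X : {set 'I_w}) : size (chi X) = w.
Proof. by rewrite size_map size_enum_ord. Qed.

Lemma eq_nth_chi w (X : {set 'I_w}) (f : nat -> nat) :
  (forall q : 'I_w, f q = (q \in X)) -> (forall a, w <= a -> f a = 0) ->
  f =1 nth 0 (chi X).
Proof.
move=> H1 H2 a; have [lt|ge] := ltnP a w.
  by have := H1 (Ordinal lt); rewrite -nth_chi.
by rewrite H2 // nth_default // size_chi.
Qed.

Lemma nth_chis w (s : seq {set 'I_w}) j (q : 'I_w) : j < size s ->
  nth 0 (chis s) (j * w + q) = (q \in nth set0 s j).
Proof.
rewrite /chis; elim: s j => //= X s IH [|j] lj.
  by rewrite nth_cat size_chi ltn_ord nth_chi.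
rewrite nth_cat size_chi mulSn -addnA ltnNge leq_addr /= addKn.
exact: IH.
Qed.

Lemma below_step w (A : {set 'I_w}) (q : 'I_w) :
  [set q' in A | q' < q.+1] =
  if q \in A then q |: [set q' in A | q' < q] else [set q' in A | q' < q].
Proof.
apply/setP => q'; rewrite (fun_if (fun B : {set 'I_w} => q' \in B)) !inE.
rewrite ltnS leq_eqVlt -val_eqE /=; case: (eqVneq (q' : nat) q) => [e|_] /=.
  have -> : q' = q by apply/val_inj.
  by rewrite andbT ltnn andbF; case: ifP.
by case: ifP; rewrite ?orbF.
Qed.

Lemma card_below_step w (A : {set 'I_w}) (q : 'I_w) :
  #|[set q' in A | q' < q.+1]| = (q \in A) + #|[set q' in A | q' < q]|.
Proof.
by rewrite below_step; case: ifP => //= _; rewrite cardsU1 inE ltnn andbF.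
Qed.

Lemma below0 w (A : {set 'I_w}) : [set q in A | q < 0] = set0.
Proof. by apply/setP => q; rewrite !inE andbF. Qed.

Lemma below_all w (A : {set 'I_w}) : [set q in A | q < w] = A.
Proof. by apply/setP => q; rewrite inE ltn_ord andbT. Qed.

(** * Correctness and amortised cost of the closure program *)

Section Closure.

Variables (w : nat) (Sigma : seq (implication 'I_w)) (k : nat) (d : seq nat).
Implicit Types (m : store) (P U X : {set 'I_w}) (q : 'I_w) (j : nat).

Notation h := (size Sigma).
Definition prm j : {set 'I_w} := nth set0 [seq r.1 | r <- Sigma] j.
Definition cnc j : {set 'I_w} := nth set0 [seq r.2 | r <- Sigma] j.

Definition inputs m : Prop :=
  [/\ m 0 =1 nth 0 [:: w; k; h; size d],
      m 1 =1 nth 0 (chis [seq r.1 | r <- Sigma]),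
      m 2 =1 nth 0 (chis [seq r.2 | r <- Sigma])
    & m 3 =1 nth 0 d].

Lemma inputs_frame m m' : (forall b, b < 4 -> m' b =1 m b) ->
  inputs m -> inputs m'.
Proof. by move=> H [i0 i1 i2 i3]; split=> a; rewrite H. Qed.

Lemma inputs_exec p m m' o t : exec p m m' o t ->
  all (fun b => ~~ writes p b) (iota 0 4) -> inputs m -> inputs m'.
Proof.
move=> E /allP H; apply: inputs_frame => b lb; apply: (exec_frame E).
by apply: H; rewrite mem_iota.
Qed.

Lemma inputs_update m b a v : 3 < b -> inputs m -> inputs (update m b a v).
Proof.
move=> lb; apply: inputs_frame => b' lb' a'.
by rewrite /update ltn_eqF // (leq_trans lb').
Qed.

Lemma inputs_w m : inputs m -> m 0 0 = w. Proof. by case=> ->. Qed.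
Lemma inputs_k m : inputs m -> m 0 1 = k. Proof. by case=> ->. Qed.
Lemma inputs_h m : inputs m -> m 0 2 = h. Proof. by case=> ->. Qed.

Lemma inputs_prm m j q : inputs m -> j < h -> m 1 (j * w + q) = (q \in prm j).
Proof. by case=> _ -> _ _ lj; rewrite nth_chis // size_map. Qed.

Lemma inputs_cnc m j q : inputs m -> j < h -> m 2 (j * w + q) = (q \in cnc j).
Proof. by case=> _ _ -> _ lj; rewrite nth_chis // size_map. Qed.

(* [U] is the current set and [P] its part whose elements have been processed;
   the remaining ones are stacked. *)
Definition stacked m P U : Prop :=
  [/\ m bCl =1 nth 0 (chi U), P \subset U & exists s : seq 'I_w,
    [/\ uniq s, s =i U :\: P, m bTop 0 = size s &
        forall i, i < size s -> m bStack i = nth 0 (map val s) i]].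

Lemma stacked_frame m m' P U : m' bCl =1 m bCl -> m' bTop =1 m bTop ->
  m' bStack =1 m bStack -> stacked m P U -> stacked m' P U.
Proof.
move=> e1 e2 e3 [c PU [s [us ds ts ns]]]; split=> //; first by move=> a; rewrite e1.
by exists s; split=> //; rewrite ?e2 // => i /ns; rewrite e3.
Qed.

Lemma push_spec v m P U q : v \notin [:: bCl; bStack; bTop] ->
  stacked m P U -> q \notin U -> m v 0 = q ->
  wp (push v) m (fun m' _ t => stacked m' P (q |: U) /\ t <= 20).
Proof.
rewrite !inE => /norP[n1 /norP[n2 n3]] [c PU [s [us ds ts ns]]] qU vq.
apply/wp_seq/wp_set/wp_seq/wp_set/wp_set; split=> //=.
have qP : q \notin P by apply: contra qU; apply: subsetP.
rewrite /update /= (negbTE n1) vq; split.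
- apply: eq_nth_chi => [q'|a wa] /=.
    by rewrite !inE -val_eqE c nth_chi /=; case: (_ == _ :> nat).
  by rewrite gtn_eqF ?(leq_trans (ltn_ord q)) // c nth_default // size_chi.
- by rewrite (subset_trans PU) // subsetUr.
- exists (rcons s q); split.
  + by rewrite rcons_uniq us ds !inE (negbTE qU) andbF.
  + move=> q'; rewrite mem_rcons !inE ds !inE.
    by case: (eqVneq q' q) => [->|] //=; rewrite qP.
  + by rewrite size_rcons /= ts addn1.
  + move=> i; rewrite size_rcons ltnS map_rcons nth_rcons size_map /= ts.
    rewrite leq_eqVlt => /orP[/eqP->|lti]; first by rewrite ltnn !eqxx.
    by rewrite lti (ltn_eqF lti) ns.
Qed.

Lemma fire_spec m P U j : inputs m -> j < h -> m bRow 0 = j * w ->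
  stacked m P U ->
  wp fire m (fun m' _ t => stacked m' P (U :|: cnc j) /\ t <= 60 * w.+1).
Proof.
move=> im lj rj st.
apply: (wp_forc (fun i m' _ => [/\ inputs m', m' bRow 0 = j * w &
    stacked m' P (U :|: [set q in cnc j | q < i])]) 40 w) => //.
- split=> //.
  by rewrite below0 setU0.
- by move=> i m' _ _ [/inputs_w].
- move=> i m' o lti vi [im' rj' st'].
  pose q := Ordinal lti.
  have EU : (U :|: [set q in cnc j | q < i.+1]) =
            if q \in cnc j then q |: (U :|: [set q in cnc j | q < i])
            else U :|: [set q in cnc j | q < i].
    by rewrite (below_step _ q); case: ifP => // _; rewrite setUCA.
  apply: wp_if; rewrite /= rj' vi -[i]/(nat_of_ord q) inputs_cnc //.
  have [cE _ _] := st'; rewrite cE nth_chi.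
  set V := U :|: _ in st' EU *.
  have [/andP[qB qV]|qn] := boolP ((q \in cnc j) && (q \notin V)).
    rewrite qB (negbTE qV) /=.
    have H := @push_spec bI _ _ _ q isT st' qV vi.
    apply: wp_conseq H _ => m1 o1 t1 E1 [st1 t1le].
    split; last by move: t1le; clear; lia.
    rewrite EU qB; split.
    + by apply: inputs_update => //; apply: inputs_exec E1 _ im'.
    + by rewrite /update /= (exec_frame E1).
    + exact: stacked_frame st1.
  rewrite (_ : (_ != 0) = false); last first.
    by move: qn; case: (q \in cnc j); case: (q \in V).
  apply: wp_skip; split=> //; split=> //.
  have -> : U :|: [set q in cnc j | q < i.+1] = V; last exact: stacked_frame st'.
  rewrite EU; case: ifP qn => //= _; rewrite negbK => qV.
  by apply/setUidPr; rewrite sub1set.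
- move=> m' o t [_ _ st'] tle; split; last first.
    by apply: leq_trans tle _; rewrite /=; lia.
  by rewrite below_all in st'.
Qed.

Lemma cl_rule j X : j < h -> prm j \subset cl Sigma X -> cnc j \subset cl Sigma X.
Proof.
move=> lj; rewrite /prm /cnc !(nth_map (set0, set0)) //.
by apply: Mod_rule (cl_Mod _ _) (mem_nth _ lj).
Qed.

(** The second half says that completed implications have fired. Once the stack is empty, [P = U],
    and it states that [U] is closed. *)
Definition cnt_ok m U P j : Prop :=
  m bCount j = #|prm j :\: P| /\ (prm j \subset P -> cnc j \subset U).

Lemma cnt_ok_frame m m' U U' P j : m' bCount =1 m bCount -> U \subset U' ->
  cnt_ok m U P j -> cnt_ok m' U' P j.
Proof. by move=> e UU' [c1 c2]; split=> [|/c2 c]; rewrite ?e ?(subset_trans c). Qed.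

Lemma init_counts_spec m X : inputs m -> stacked m set0 X ->
  wp init_counts m (fun m' _ t => exists U,
    [/\ stacked m' set0 U, X \subset U, U \subset cl Sigma X,
        forall j, j < h -> cnt_ok m' U set0 j & t <= 300 * h.+1 * w.+1]).
Proof.
move=> im st; apply/wp_seq/wp_set.
apply: (wp_forc (fun i m' _ => [/\ inputs m', m' bRow 0 = i * w & exists U,
  [/\ stacked m' set0 U, X \subset U, U \subset cl Sigma X &
      forall j, j < i -> cnt_ok m' U set0 j]]) (200 * w.+1) h) => //=.
- split=> //; exists X; split=> //; exact: sub_cl.
- by move=> i m' _ _ [/inputs_h].
- move=> i {im st m} m o lti vi [im ri [U [st XU Ucl ok]]].
  apply/wp_seq/wp_set; rewrite /= vi; set m1 := update _ _ _ _; apply: wp_seq.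
  have im1 : inputs m1 by apply: inputs_update.
  apply: (wp_forc (fun i' m' _ => [/\ inputs m', m' bRow 0 = i * w /\ m' bJ 0 = i,
     stacked m' set0 U, (forall j, j < i -> cnt_ok m' U set0 j) &
     m' bCount i = #|[set q in prm i | q < i']|]) 40 w) => //=.
  + split=> //; last by rewrite /m1 /update /= eqxx below0 cards0.
    move=> j ltj; case: (ok _ ltj) => c1 c2.
    by split; rewrite // /m1 /update /= (ltn_eqF ltj).
  + by move=> i' m' _ _ [/inputs_w].
  + move=> i' m' o' lti' vi' [im' [ri' ji'] st' ok' ci'].
    apply: wp_set; rewrite /= ji' ri' vi'; split; last by [].
    split=> //.
      move=> j ltj; case: (ok' _ ltj) => c1 c2.
      by split=> //; rewrite /update /= (ltn_eqF ltj).
    rewrite /update /= eqxx ci' -[in m' 1 _]/(nat_of_ord (Ordinal lti')).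
    by rewrite inputs_prm // addnC (card_below_step _ (Ordinal lti')).
  + move=> m' o' t [im' [ri' ji'] st' ok' ci'] tle.
    rewrite below_all in ci'.
    apply: wp_seq; apply: wp_if; rewrite /= ji' ci'.
    have [c0|cn0] := eqVneq #|prm i| 0 => /=; last first.
      apply: wp_skip; apply: wp_set; rewrite /= ri' inputs_w //.
      split; last by move: tle => /=; clear; lia.
      split=> //; first by rewrite mulSn addnC.
      exists U; split=> // j; rewrite ltnS leq_eqVlt => /orP[/eqP->|/ok' //].
      split; rewrite /update /= ?setD0 //.
      by rewrite subset0 -cards_eq0 (negbTE cn0).
    have H := fire_spec im' lti ri' st'.
    apply: wp_conseq H _ => m2 o2 t2 E2 [st2 t2le].
    apply: wp_set; rewrite /= (exec_frame E2) // ri' (inputs_w (m:=m2)); last first.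
      exact: inputs_exec E2 _ im'.
    split; last by move: tle t2le => /=; clear; lia.
    split=> //; first by apply: inputs_update => //; apply: inputs_exec E2 _ im'.
      by rewrite mulSn addnC.
    exists (U :|: cnc i); split=> //.
    * by rewrite (subset_trans XU) // subsetUl.
    * rewrite subUset Ucl; apply: cl_rule => //.
      by move/eqP: c0; rewrite cards_eq0 => /eqP->; apply: sub0set.
    * move=> j; rewrite ltnS leq_eqVlt => /orP[/eqP->|/ok'].
        split; last by rewrite subsetUr.
        by rewrite /update /= (exec_frame E2) // setD0.
      apply: cnt_ok_frame; rewrite ?subsetUl // => a.
      by rewrite /update /= (exec_frame E2).
- move=> m' o t [im' ri' [U [st' XU Ucl ok]]] tle; exists U; split=> //.
  move: tle (leq_pmulr h.+1 (ltn0Sn w)); rewrite /= mulnDr mulnCA -mulnA.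
  by move: (h.+1 * w.+1); clear; lia.
Qed.

(* An implication fires when the last element of its premise is processed, so
   that its total cost over a run is paid for by a drop of [unsat]. *)
Definition unsat P : nat := \sum_(0 <= j < h) ~~ (prm j \subset P).

Lemma unsat_split P P' : P \subset P' ->
  \sum_(0 <= j < h) (~~ (prm j \subset P) && (prm j \subset P')) + unsat P' =
  unsat P.
Proof.
move=> PP'; rewrite -big_split; apply: eq_bigr => j _ /=.
have := @subset_trans _ (prm j) P P' ; case: (prm j \subset P) => /=.
  by move=> /(_ isT PP') ->.
by case: (prm j \subset P').
Qed.

(** [p] has already left the stack, whereas the counters still refer to [P]; the loop moves them to
    [p |: P] row by row. The time bound is amortised with [unsat] as potential. *)
Lemma process_spec m P U X p : inputs m -> stacked m (p |: P) U -> p \notin P ->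
  U \subset cl Sigma X -> (forall j, j < h -> cnt_ok m U P j) ->
  m bPop 0 = p -> m bRow 0 = 0 ->
  wp process m (fun m' _ t => exists U',
    [/\ stacked m' (p |: P) U', U \subset U', U' \subset cl Sigma X,
        forall j, j < h -> cnt_ok m' U' (p |: P) j &
        t + 70 * w.+1 * unsat (p |: P) <=
          60 * h.+1 + 70 * w.+1 * unsat P]).
Proof.
move=> im st pP Ucl ok pop r0.
(* A row pays for [fire] only if [p] completes its premise; summed over the rows, these terms are
   the drop of [unsat]. *)
pose c j := 40 + 70 * w.+1 * (~~ (prm j \subset P) && (prm j \subset p |: P)).
apply: (wp_for (fun i m' _ => [/\ inputs m', m' bRow 0 = i * w, m' bPop 0 = p &
  exists U', [/\ stacked m' (p |: P) U', U \subset U', U' \subset cl Sigma X &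
    forall j, j < h -> cnt_ok m' U' (if j < i then p |: P else P) j]]) c h) => //=.
- by split=> //; exists U; split.
- by move=> i m' _ _ [/inputs_h].
- move=> i {im st Ucl ok pop r0} {}m o lti vi.
  move=> [im ri pop [U1 [st UU1 U1cl ok]]].
  apply: wp_seq; apply: wp_if; rewrite /= ri pop inputs_prm //.
  have [okc okf] := ok _ lti; rewrite ltnn in okc okf.
  have Psub : P \subset p |: P by apply: subsetUr.
  have prmP : p \notin prm i -> prm i :\: (p |: P) = prm i :\: P.
    move=> pn; apply/setP => q; rewrite !inE; case: (eqVneq q p) => //= ->.
    by rewrite (negbTE pn) andbF.
  have [pin|pn] := boolP (p \in prm i) => /=; last first.
    apply: wp_skip; apply: wp_set; rewrite /= ri (inputs_w im).
    split; last by rewrite /c.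
    split=> //; first by rewrite mulSn addnC.
    exists U1; split=> // j /ok; rewrite ltnS (leq_eqVlt j i).
    case: (eqVneq j i) => [->|//]; rewrite ltnn /= => -[c1 c2]; split.
      by rewrite prmP.
    move=> s1; apply: c2; apply/subsetP => q qin; have := subsetP s1 _ qin.
    rewrite !inE; case: eqP => // qp; by rewrite -qp qin in pn.
  have npin : ~~ (prm i \subset P) by apply/subsetPn; exists p.
  have cE : m bCount i - 1 = #|prm i :\: (p |: P)|.
    rewrite okc (cardsD1 p) !inE pP pin addKn; apply: eq_card => q.
    by rewrite !inE negb_or andbA.
  apply/wp_seq/wp_set; rewrite /= vi; apply: wp_if.
  set m1 := update _ _ _ _; have e1 : m1 bJ 0 = i by [].
  have e2 : m1 bCount i = #|prm i :\: (p |: P)| by rewrite /m1 /update /= eqxx cE.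
  have e3 : m1 bRow 0 = i * w by [].
  have im1 : inputs m1 by apply: inputs_update.
  rewrite /= e1 e2.
  have oks m2 U2 j : j < h -> m2 bCount =1 m1 bCount -> U1 \subset U2 ->
    (prm i \subset p |: P -> cnc i \subset U2) ->
    cnt_ok m2 U2 (if j < i.+1 then p |: P else P) j.
    move=> lj e UU f; have := ok _ lj; rewrite ltnS (leq_eqVlt j i).
    case: (eqVneq j i) => [->|nji] /=.
      by move=> _; split; rewrite ?e /m1 /update //= eqxx cE.
    move=> [c1 c2]; split; last by move=> /c2 h2; apply: subset_trans h2 UU.
    by rewrite e /m1 /update /= (negbTE nji).
  have [c0|cn0] := eqVneq #|prm i :\: (p |: P)| 0 => /=; last first.
    apply: wp_skip; apply: wp_set; rewrite /= e3 (inputs_w im1).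
    split; last by rewrite /c.
    split=> //; first by rewrite mulSn addnC.
    exists U1; split=> // j lj; apply: oks => // s1; case/negP: cn0.
    by rewrite cards_eq0 setD_eq0.
  have st1 : stacked m1 (p |: P) U1 by apply: stacked_frame st.
  have H := fire_spec im1 lti ri st1; apply: wp_conseq H _ => m2 o2 t2 E2 [st2 t2le].
  have im2 : inputs m2 by apply: inputs_exec E2 _ im1.
  have s1 : prm i \subset p |: P by rewrite -setD_eq0 -cards_eq0 c0.
  apply: wp_set; rewrite /= (exec_frame E2) // e3 (inputs_w im2).
  split; last by rewrite /c npin s1; move: t2le; clear; lia.
  split=> //; [by rewrite mulSn addnC | by rewrite /update /= (exec_frame E2) |].
  exists (U1 :|: cnc i); split=> //.
  + by rewrite (subset_trans UU1) // subsetUl.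
  + rewrite subUset U1cl; apply: cl_rule => //; apply: subset_trans U1cl.
    by apply: subset_trans s1 _; case: st.
  + move=> j lj; apply: oks => //; rewrite ?subsetUl ?subsetUr //.
    by move=> a; rewrite /update /= (exec_frame E2).
- move=> m' o t [im' ri' _ [U' [st' UU' Ucl' ok']]] tle; exists U'; split=> //.
    by move=> j lj; have := ok' j lj; rewrite lj.
  move: tle; rewrite /c big_split /= sum_nat_const_nat subn0 -big_distrr /=.
  rewrite -(@unsat_split P (p |: P)) ?subsetUr // (mulnDr (70 * w.+1)).
  set s := \sum_(0 <= _ < _) _; move: (70 * w.+1 * s) (70 * w.+1 * unsat _).
  by clear; lia.
Qed.

Lemma drain_spec m P U X : 0 < h -> inputs m -> stacked m P U -> X \subset U ->
  U \subset cl Sigma X -> (forall j, j < h -> cnt_ok m U P j) ->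
  wp drain m (fun m' _ t =>
    [/\ m' bCl =1 nth 0 (chi (cl Sigma X)) &
        t <= 10 + #|~: P| * (150 * h) + 70 * w.+1 * unsat P]).
Proof.
move=> h0; have [n] := ubnP #|~: P|.
elim: n m P U => // n IH m P U Pn im st XU Ucl ok.
have [cE PU [s [us ds ts ns]]] := st.
case/lastP: s us ds ts ns => [|s p] us ds ts ns.
  apply: wp_while0 => //=; split; last by [].
  (* With an empty stack all of [U] is processed, so the counters certify that [U] is closed, hence
     equal to the closure. *)
  have UP : U = P.
    apply/eqP; rewrite eqEsubset PU andbT; apply/subsetP => q qU.
    by have := ds q; rewrite inE qU andbT in_nil => /esym/negbFE.
  suff -> : cl Sigma X = U by [].
  apply/eqP; rewrite eqEsubset Ucl andbT; apply: cl_min => //.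
  rewrite inE; apply/(all_nthP (set0, set0)) => j lj; apply/implyP.
  have [_] := ok _ lj; rewrite -UP /prm /cnc !(nth_map (set0, set0)) //.
rewrite size_rcons in ts; rewrite rcons_uniq in us; case/andP: us => ps us.
have /andP[pP pU] : (p \notin P) && (p \in U).
  by have := ds p; rewrite mem_rcons !inE eqxx.
apply: wp_whileS; first by rewrite /= ts.
apply/wp_seq/wp_set/wp_seq/wp_set/wp_seq/wp_set => /=.
set m1 := update _ bRow _ _.
have top1 : update m bTop 0 (m bTop 0 - 1) bTop 0 = size s.
  by rewrite /update /= ts subn1.
have pop1 : m1 bPop 0 = p.
  rewrite /m1 /update /= ts subn1 /= ns ?size_rcons //.
  by rewrite map_rcons nth_rcons size_map ltnn eqxx.
have st1 : stacked m1 (p |: P) U.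
  split=> //; first by rewrite subUset sub1set pU.
  exists s; split=> //.
  - move=> q; have := ds q; rewrite mem_rcons !inE negb_or.
    by case: (eqVneq q p) => [->|_] /=; [rewrite (negbTE ps) | move=> ->].
  - move=> i lti; rewrite /m1 /update /= ns; last by rewrite size_rcons ltnS ltnW.
    by rewrite map_rcons nth_rcons size_map lti.
have im1 : inputs m1 by [].
have H := process_spec im1 st1 pP Ucl ok pop1 erefl.
apply: wp_conseq H _ => m2 o2 t2 E2 [U2 [st2 UU2 U2cl ok2 t2le]].
have im2 : inputs m2 by apply: inputs_exec E2 _ im1.
have card : #|~: P| = #|~: (p |: P)|.+1.
  rewrite (cardsD1 p (~: P)) in_setC pP; congr _.+1; apply: eq_card => q.
  by rewrite !inE negb_or.
have lt2 : #|~: (p |: P)| < n by move: Pn; rewrite card.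
have H := IH _ _ _ lt2 im2 st2 (subset_trans XU UU2) U2cl ok2.
apply: wp_conseq H _ => m3 o3 t3 E3 [cl3 t3le]; split=> //.
(* Apart from the drop of [unsat], a round costs at most 60(h + 1) plus a constant, and h >= 1
   brings this below 150 h. *)
rewrite card mulSn; move: t2le t3le h0.
move: (#|_| * _) (_ * unsat _) (_ * unsat _).
by clear; lia.
Qed.

Definition close : cmd := init_counts ;; drain.

Lemma close_spec m X : 0 < h -> 0 < w -> inputs m -> stacked m set0 X ->
  wp close m (fun m' _ t =>
    [/\ m' bCl =1 nth 0 (chi (cl Sigma X)) & t <= 2000 * (h * w)]).
Proof.
move=> h0 w0 im st; apply: wp_seq.
apply: wp_conseq (init_counts_spec im st) _ => m1 o1 t1 E1.
move=> [U [st1 XU Ucl ok t1le]].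
have im1 : inputs m1 by apply: inputs_exec E1 _ im.
apply: wp_conseq (drain_spec h0 im1 st1 XU Ucl ok) _ => m2 o2 t2 _ [cl2 t2le].
split=> //; have : #|~: (set0 : {set 'I_w})| <= w.
  by rewrite setC0 cardsT card_ord.
have : unsat set0 <= h.
  rewrite /unsat -[X in _ <= X]muln1 -[X in _ <= X * _](subn0 h) -sum_nat_const_nat.
  by apply: leq_sum => j _; apply: leq_b1.
move: #|_| (unsat _) t1le t2le h0 w0 => a b t1le t2le h0 w0 bh aw.
have h2 : h.+1 <= 2 * h by move: h0; clear; lia.
have w2 : w.+1 <= 2 * w by move: w0; clear; lia.
have := leq_mul w2 bh; have := leq_mul h2 w2; have := leq_mul aw (leqnn h).
have : 0 < h * w by rewrite muln_gt0 h0.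
move: t1le t2le; rewrite -!mulnA (mulnCA a) [w * h]mulnC (mulnCA h) mulnA.
by clear; lia.
Qed.

End Closure.

(** * Viability tests *)

Fixpoint writes_below (n : nat) (p : cmd) : bool :=
  match p with
  | CSkip | COut _ => true
  | CSet b _ _ => b < n
  | CSeq p q | CIf _ p q => writes_below n p && writes_below n q
  | CWhile _ p => writes_below n p
  end.

Lemma writes_belowP n p b : writes_below n p -> n <= b -> ~~ writes p b.
Proof.
move=> + nb; elim: p => //= [b' _ _ lb|p1 H1 p2 H2|_ p1 H1 p2 H2].
- by rewrite gtn_eqF // (leq_trans lb).
- by case/andP=> /H1 /negbTE-> /H2.
- by case/andP=> /H1 /negbTE-> /H2.
Qed.

Definition eNext : expr := EAdd (Var bQ) (ECst 1).

(* On addresses beyond the depth, the path bank holds stale bits; the last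
   subtraction in [eDecided] masks them. *)
Definition eDecided : expr := ESub (EGet bPrem eNext) (ESub eNext (Var bDepth)).
Definition eBit : expr := EGet bPath (Var bQ).
(** On bits, truncated a - (1 - b) is the conjunction, and a - b the conjunction with the negation
    of b. *)
Definition eOne : expr := ESub eDecided (ESub (ECst 1) eBit).
Definition eNil : expr := ESub eDecided eBit.

Definition load_sets : cmd :=
  For bQ eW (CSet bCl (Var bQ) (ECst 0) ;; CSet bZero (Var bQ) eNil) ;;
  bTop ::= ECst 0 ;;
  For bQ eW (CIf eOne (push bQ) CSkip).

(** The results go to address w, the depth where the second half starts; [extend] continues both
    arrays from there. *)
Definition count_free : cmd :=
  CSet bMin eW (ECst 0) ;;
  CSet bMax eW (ECst 0) ;;
  For bQ eW
    (CSet bMin eW (EAdd (EGet bMin eW) (EGet bCl (Var bQ))) ;;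
     CSet bMax eW (EAdd (EGet bMax eW)
       (EAdd (EGet bCl (Var bQ))
          (ESub (ECst 1) (EAdd (EGet bPrem eNext) (EGet bCl (Var bQ))))))).

Definition check (P : cmd) : cmd :=
  load_sets ;; close ;; count_free ;; call P ;; bOk ::= Var bRes.

Definition eLast : expr := ESub (Var bDepth) (ECst 1).
(** At depth w + q + 1 the element decided last is q: its flag is in cell q + 1 of [bPrem], its
    closure bit in cell q of [bCl]. *)
Definition eFree : expr :=
  ESub (ECst 1) (EAdd (EGet bPrem (ESub (Var bDepth) eW))
                      (EGet bCl (ESub eLast eW))).

(** The three summands below the last subtraction vanish exactly if the respective conditions of
    [viable_free] hold. The maximum drops only if a free element is refused. *)
Definition extend : cmd :=
  CSet bMin (Var bDepth) (EAdd (EGet bMin eLast) (EGet bPath eLast)) ;;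
  CSet bMax (Var bDepth) (ESub (EGet bMax eLast) (ESub eFree (EGet bPath eLast))) ;;
  bOk ::= ESub (ECst 1)
    (EAdd (EAdd (ESub (EGet bMin (Var bDepth)) eK)
                (ESub eK (EGet bMax (Var bDepth))))
          (ESub (EGet bPath eLast) eFree)).

(** For 1 <= i <= w, the element decided last at depth i has its flag in cell i of [bPrem], thanks
    to the shift by one. A level without flag accepts only the bit 0. *)
Definition test (P : cmd) : cmd :=
  CIf (ESub (Var bDepth) eW) extend
    (CIf (EGet bPrem (Var bDepth)) (check P)
       (bOk ::= ESub (ECst 1) (EGet bPath eLast))).

Definition leaf : cmd :=
  For bQ eW (COut (EAdd (EGet bCl (Var bQ)) (EGet bPath (EAdd eW (Var bQ))))).

(** The header of the oracle's input differs from that of the enumeration input, hence the separate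
    copy in bank 40, which is [ren 0]. *)
Definition prepare : cmd :=
  CSet 40 (ECst 0) eW ;; CSet 40 (ECst 1) eK ;; CSet 40 (ECst 2) eS ;;
  bHeight ::= EAdd eW eW ;; bPrem ::= ECst 1 ;; bRow ::= ECst 0 ;;
  For bJ eH
    (For bQ eW (CIf (EGet 1 (EAdd (Var bRow) (Var bQ)))
                    (CSet bPrem eNext (ECst 1)) CSkip) ;;
     bRow ::= EAdd (Var bRow) eW).

Definition enumeration (P : cmd) : cmd := prepare ;; trie_search (test P) leaf.

(** * Correctness of the node tests and of the leaf output *)

Section Node.

Variables (w : nat) (Sigma : seq (implication 'I_w)) (k : nat) (d : seq nat).
Variables (P : cmd) (tau : nat).
Implicit Types (m : store) (U X Y Z : {set 'I_w}) (q : 'I_w) (y : seq bool).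

Notation h := (size Sigma).
Notation inputs := (inputs Sigma k d).
Notation S := (members_of_size (Mod Sigma) k).
Notation viable := (viable S (code Sigma)).
Notation parent_viable := (parent_viable S (code Sigma)).

Hypothesis h_gt0 : 0 < h.
Hypothesis w_gt0 : 0 < w.
Hypothesis oracle : forall Z Y, Z \in Mod Sigma -> exists2 t, t <= tau &
  runs P (check_input d Z Y k)
    [:: nat_of_bool (has_disjoint_extension (Mod Sigma) Z Y k)] t.

(** Banks 40, 41 and 42 are the oracle's input banks 0, 1 and 2, so the closure and the refused
    elements are computed in place. The oracle's work banks start at 44; these and the cells past
    the vectors must be 0, because the oracle is specified from a freshly loaded memory. [A] is a
    parameter since [prepare] fills [bPrem] gradually. *)
Definition ready (A : {set 'I_w}) m : Prop :=
  [/\ inputs m,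
      m 40 =1 nth 0 [:: w; k; size d] /\ (forall b a, 43 < b -> m b a = 0),
      m bLog 0 = 0 /\ m bHeight 0 = w + w,
      m bPrem 0 = 1 /\ (forall q, m bPrem q.+1 = (q \in A)) &
      forall a, w <= a -> m bCl a = 0 /\ m bZero a = 0].

Notation static := (ready (premises Sigma)).

Lemma ready_frame A m m' :
  (forall b, b \in [:: 0; 1; 2; 3; 6; 19; 40] -> m' b =1 m b) ->
  m' bLog 0 = m bLog 0 ->
  (forall b, 43 < b -> m' b =1 m b) ->
  (forall a, w <= a -> m bCl a = 0 -> m bZero a = 0 ->
     m' bCl a = 0 /\ m' bZero a = 0) ->
  ready A m -> ready A m'.
Proof.
move=> H Hl H43 Ht [im [m40 m43] [ml mh] [p0 pq] tl]; split.
- apply: inputs_frame im => b lb; apply: H; rewrite !inE.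
  by case: b lb => [|[|[|[|]]]].
- by split=> [a|b a lb]; [rewrite H ?m40 | rewrite H43 ?m43].
- by rewrite Hl H.
- by split=> [|q]; rewrite H.
- by move=> a wa; have [t1 t2] := tl _ wa; apply: Ht.
Qed.

Lemma static_exec p m m' o t : exec p m m' o t ->
  all (fun b => ~~ writes p b) [:: 42; bLog; 0; 1; 2; 3; 6; 19; 40] ->
  writes_below 44 p ->
  m' bCl =1 m bCl \/ (exists U, m' bCl =1 nth 0 (chi U)) -> static m -> static m'.
Proof.
move=> E /allP H /writes_belowP H43 mCl; apply: ready_frame.
- by move=> b bin; apply: (exec_frame E); apply: H; rewrite 2!in_cons bin !orbT.
- by apply: (exec_frame E); apply: H.
- by move=> b lb; apply: (exec_frame E); apply: H43.
- move=> a wa c0 z0; split; last by rewrite (exec_frame E) ?H.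
  by case: mCl => [->//|[U ->]]; rewrite nth_default // size_chi.
Qed.

Lemma ready_update A m b a v : b \notin [:: bLog; 0; 1; 2; 3; 6; 19; 40] -> b < 44 ->
  (b \in [:: bCl; bZero] -> a < w) -> ready A m -> ready A (update m b a v).
Proof.
move=> nb b43 lw; apply: ready_frame => [b' b'in a'||b' lb a'|a' wa c0 z0].
- by rewrite /update; case: eqP => // e; rewrite -e in_cons b'in orbT in nb.
- by rewrite /update; case: eqP => // e; rewrite -e in nb.
- by rewrite /update gtn_eqF // (leq_trans b43).
- rewrite /update; have [e|] := eqVneq a' a; last by rewrite !andbF.
  rewrite !andbT; split; case: eqP => // eb; exfalso.
    by move: lw; rewrite -eb -e ltnNge wa => /(_ isT).
  by move: lw; rewrite -eb -e ltnNge wa => /(_ isT).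
Qed.

Lemma ready_w A m : ready A m -> m 0 0 = w. Proof. by case=> /inputs_w. Qed.
Lemma static_k m : static m -> m 0 1 = k. Proof. by case=> /inputs_k. Qed.

Lemma holds_exec p m m' o t y : exec p m m' o t ->
  ~~ writes p bDepth -> ~~ writes p bPath -> holds_path y m -> holds_path y m'.
Proof. by move=> E w1 w2; apply: holds_agree => [|a]; rewrite (exec_frame E). Qed.

Lemma eval_decided m y q : static m -> holds_path y m -> m bQ 0 = q ->
  eval m eOne = (q \in ones Sigma y) /\ eval m eNil = (q \in zeros Sigma y).
Proof.
move=> [_ _ _ [_ pq] _] [h1 h2] vq; rewrite /= vq addn1 pq h1 !inE.
have [lt|ge] := ltnP q (size y).
  rewrite h2 // (eqP (lt : _ - _ == _)) subn0.
  by case: (q \in _); case: (nth _ _ _).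
have -> : (q \in premises Sigma) - (q.+1 - size y) = 0.
  by apply/eqP; rewrite subn_eq0 (leq_trans (leq_b1 _)) // subn_gt0.
by rewrite (nth_default _ ge) !sub0n /= !andbF.
Qed.

Lemma load_sets_spec m y : static m -> holds_path y m ->
  wp load_sets m (fun m' _ t => [/\ stacked m' set0 (ones Sigma y),
    m' bZero =1 nth 0 (chi (zeros Sigma y)), static m', holds_path y m'
    & t <= 200 * w.+1]).
Proof.
move=> sm hm; apply: wp_seq.
apply: (wp_forc (fun i m' _ => [/\ static m', holds_path y m',
   forall a, a < i -> m' bCl a = 0 &
   forall q, q < i -> m' bZero q = (q \in zeros Sigma y)]) 40 w) => //.
- by split=> //; apply: ready_update.
- by move=> i m' _ _ [/ready_w].
- move=> i m1 o lti vi [sm1 hm1 c1 z1]; pose q := Ordinal lti.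
  apply/wp_seq/wp_set/wp_set; split; last by [].
  set m2 := update m1 bCl _ _.
  have s2 : static m2 by apply: ready_update => //=; rewrite vi.
  have h2 : holds_path y m2 by apply: holds_agree hm1.
  have [_ ->] := eval_decided s2 h2 (vi : _ = q :> nat).
  rewrite /= (vi : m2 bQ 0 = i) /m2 /= vi; split=> //.
  + by do !apply: ready_update => //.
  + move=> a; rewrite ltnS leq_eqVlt /update /=.
    by case: (eqVneq a i) => //= _ /c1.
  + move=> q'; rewrite ltnS leq_eqVlt /update /=.
    case: (eqVneq (q' : nat) i) => [e _|_ /= /z1 //].
    by have -> : q = q' by apply/val_inj; rewrite /= e.
move=> m1 o1 t1 [sm1 hm1 c1 z1] t1le.
have Z1 : m1 bZero =1 nth 0 (chi (zeros Sigma y)).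
  apply: eq_nth_chi => [q|a wa]; first exact: z1.
  by case: sm1 => _ _ _ _ /(_ _ wa)[].
have C1 : m1 bCl =1 nth 0 (chi (set0 : {set 'I_w})).
  apply: eq_nth_chi => [q|a wa]; first by rewrite inE c1.
  by case: sm1 => _ _ _ _ /(_ _ wa)[].
apply/wp_seq/wp_set => /=.
apply: (wp_forc (fun i m' _ => [/\ static m', holds_path y m',
   m' bZero =1 nth 0 (chi (zeros Sigma y)) &
   stacked m' set0 [set q in ones Sigma y | q < i]]) 40 w) => //.
- split=> //; first by do !apply: ready_update => //.
  rewrite below0; split=> //; exists [::]; split=> // q.
  by rewrite !inE.
- by move=> i m' _ _ [/ready_w].
- move=> i m2 o2 lti vi [sm2 hm2 z2 st2]; pose q := Ordinal lti.
  apply: wp_if; have [-> _] := eval_decided sm2 hm2 (vi : _ = q :> nat).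
  rewrite (below_step (ones Sigma y) q).
  have [qin|qn] /= := boolP (q \in ones Sigma y); last first.
    by apply: wp_skip; split=> //; split=> //; apply: ready_update.
  have qn : q \notin [set q in ones Sigma y | q < i] by rewrite inE ltnn andbF.
  have H := @push_spec _ bQ _ _ _ q isT st2 qn vi.
  apply: wp_conseq H _ => m3 o3 t3 E3 [st3 t3le]; split; last first.
    by move: t3le; clear; lia.
  split=> //.
  + apply: ready_update => //; apply: (static_exec E3) => //.
    by right; case: st3 => c3 _ _; exists (q |: [set q in ones Sigma y | q < i]).
  + exact: (holds_exec E3).
  + by move=> a; rewrite /update /= (exec_frame E3).
- move=> m2 o2 t2 [sm2 hm2 z2]; rewrite below_all => st2 t2le; split=> //.
  by move: t1le t2le => /=; clear; lia.
Qed.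

Lemma count_free_spec m U : static m -> m bCl =1 nth 0 (chi U) ->
  wp count_free m (fun m' _ t => [/\ m' bMin w = #|U|,
    m' bMax w = #|U| + #|~: (premises Sigma :|: U)| & t <= 200 * w.+1]).
Proof.
move=> sm cU; apply/wp_seq/wp_set/wp_seq/wp_set => /=; rewrite (ready_w sm).
set F := ~: _.
apply: (wp_forc (fun i m' _ => [/\ static m', m' bCl =1 nth 0 (chi U),
   m' bMin w = #|[set q in U | q < i]| &
   m' bMax w = #|[set q in U | q < i]| + #|[set q in F | q < i]|]) 80 w) => //.
- split=> //; first by do !apply: ready_update => //.
  + by rewrite below0 cards0 /update /= eqxx.
  + by rewrite !below0 !cards0 /update /= (ready_w sm) eqxx.
- by move=> i m' _ _ [/ready_w].
- move=> i m1 o lti vi [sm1 cU1 mn1 mx1]; pose q := Ordinal lti.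
  apply/wp_seq/wp_set; set m2 := update _ _ _ _; apply/wp_set.
  have m2E b a : b != bMin -> m2 b a = m1 b a by rewrite /m2 /update => /negbTE->.
  split; last by [].
  have cq : m1 bCl i = (q \in U) by rewrite cU1 -nth_chi.
  have pq : m1 bPrem (i + 1) = (q \in premises Sigma).
    by case: sm1 => _ _ _ [_ <-] _; rewrite addn1.
  rewrite (card_below_step U q) (card_below_step F q) /=.
  rewrite !m2E // vi cq pq (ready_w sm1) mx1 /m2 /= vi (ready_w sm1) cq mn1.
  split=> //; first by do !apply: ready_update => //.
    by rewrite /update /= eqxx addnC.
  rewrite /update /= eqxx !inE.
  case: (q \in premises Sigma); case: (q \in U) => /=; lia.
- move=> m1 o1 t1 [_ _ mn1 mx1]; rewrite !below_all in mn1 mx1 => tle.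
  by split=> //; move: tle => /=; clear; lia.
Qed.

(** Whole memories must coincide, cell by cell, since [runs] speaks of [load] only. *)
Lemma view_load m Z Y : static m -> m bCl =1 nth 0 (chi Z) ->
  m bZero =1 nth 0 (chi Y) -> view m = load (check_input d Z Y k).
Proof.
move=> [[_ _ _ m3] [m40 m43] _ _ _] mZ mY; apply/funext => b; apply/funext => a.
rewrite /view /load; case: b => [|[|[|[|b]]]] //=.
by rewrite m43 // nth_nil nth_nil.
Qed.

(** The entries of all depths from w to the current one stay valid, so that those of an ancestor are
    at hand when the search climbs back. Up to depth w the range is the single [j = w]. *)
Definition dyn y m : Prop :=
  m bCl =1 nth 0 (chi (cl Sigma (ones Sigma y))) /\
  forall j, w <= j <= maxn w (size y) ->
    m bMin j = #|cl Sigma (ones Sigma y)| + #|chosen w j y| /\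
    m bMax j = #|cl Sigma (ones Sigma y)| + #|chosen w j y| +
               #|undecided Sigma j y|.

Definition check_cost : nat :=
  2400 * (h * w) + 1000 + 100 * (size (banks P)).+1 * tau.+1.

Lemma check_spec m y : static m -> holds_path y m -> size y <= w ->
  wp (check P) m (fun m' _ t => [/\ static m', dyn y m',
    m' bOk 0 = has_disjoint_extension (Mod Sigma)
                 (cl Sigma (ones Sigma y)) (zeros Sigma y) k
    & t <= check_cost]).
Proof.
move=> sm hm yw; apply: wp_seq.
apply: wp_conseq (load_sets_spec sm hm) _ => m1 o1 t1 _ [st1 z1 sm1 hm1 t1le].
apply: wp_seq; have im1 : inputs m1 by case: sm1.
apply: wp_conseq (close_spec h_gt0 w_gt0 im1 st1) _ => m2 o2 t2 E2 [c2 t2le].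
set U := cl _ _ in c2 *.
have z2 : m2 bZero =1 nth 0 (chi (zeros Sigma y)).
  by move=> a; rewrite (exec_frame E2).
have sm2 : static m2 by apply: (static_exec E2) => //; right; exists U.
apply: wp_seq.
apply: wp_conseq (count_free_spec sm2 c2) _ => m3 o3 t3 E3 [mn3 mx3 t3le].
have sm3 : static m3.
  by apply: (static_exec E3) => //; left=> a; rewrite (exec_frame E3).
have c3 : m3 bCl =1 nth 0 (chi U) by move=> a; rewrite (exec_frame E3).
have z3 : m3 bZero =1 nth 0 (chi (zeros Sigma y)).
  by move=> a; rewrite (exec_frame E3).
have [t tle [v E]] := oracle (zeros Sigma y) (cl_Mod Sigma (ones Sigma y)).
rewrite -(view_load sm3 c3 z3) in E.
apply: wp_seq; have l3 : m3 bLog 0 = 0 by case: sm3 => _ _ [].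
apply: wp_conseq (call_spec E l3) _ => m4 o4 t4 E4 [v4 l4 r4 t4le].
(* The call restores every bank the oracle can see, including those that hold the closure and the
   refused elements. *)
have ve b : m4 (ren b) =1 m3 (ren b).
  by move=> a; rewrite -[LHS]/(view m4 b a) v4.
have c4 : m4 bCl =1 m3 bCl by apply: (ve 1).
have fr4 b : b < 40 -> b \notin [:: 3; bAddr; bBank; bOld; bLog; bRes] ->
    m4 b =1 m3 b.
  rewrite inE => b40 /norP[b3 nb]; apply: (exec_frame E4).
  exact: writes_call.
have sm4 : static m4.
  apply: ready_frame sm3.
  - move=> b bin a; have /allP/(_ b bin) : all (fun b =>
        [|| b == 3, b == 40 |
            (b < 40) && (b \notin [:: 3; bAddr; bBank; bOld; bLog; bRes])])
        [:: 0; 1; 2; 3; 6; 19; 40] by [].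
    case/or3P => [/eqP->|/eqP->|/andP[b40 nb]]; last exact: fr4.
    + exact: (ve 3).
    + exact: (ve 0).
  - by rewrite l4 l3.
  - move=> b lb; have := ve (b - 40); rewrite /ren subnKC; last lia.
    by rewrite gtn_eqF //; lia.
  - by move=> a wa; rewrite c4 (ve 2).
apply: wp_set; split.
- by apply: ready_update.
- split; first by move=> a; rewrite /update /= c4 c3.
  move=> j; rewrite (maxn_idPl yw) -eqn_leq => /eqP <-.
  rewrite /update /= !fr4 // mn3 mx3.
  have -> : chosen w w y = set0.
    by apply/setP => q; rewrite !inE ltnNge leq_addr.
  have -> : undecided Sigma w y = ~: (premises Sigma :|: U).
    by apply/setP => q; rewrite !inE leq_addr andbT.
  by rewrite cards0 !addn0.
- by rewrite /update /= r4.
- have : 100 * (size (banks P)).+1 * t.+1 <= 100 * (size (banks P)).+1 * tau.+1.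
    by rewrite leq_mul2l ltnS tle orbT.
  have : w <= h * w by rewrite leq_pmull.
  rewrite /check_cost /=; move: t1le t2le t3le t4le.
  move: (_ * t.+1) (_ * tau.+1) (h * w); clear; lia.
Qed.

Lemma chosen_w y : chosen w w y = set0.
Proof. by apply/setP => q; rewrite !inE ltnNge leq_addr. Qed.

Lemma chosen_frame j y b : j <= size y -> chosen w j (rcons y b) = chosen w j y.
Proof.
move=> jy; apply/setP => q; rewrite !inE nth_rcons.
by have [lt|//] := ltnP (w + q) j; rewrite (leq_trans lt).
Qed.

Lemma undecided_rcons j y b : ~~ (b && (size y < w)) ->
  undecided Sigma j (rcons y b) = undecided Sigma j y.
Proof. by move=> nb; rewrite /undecided /free_elts ones_rcons. Qed.

Lemma dyn_parent y b m : w <= size y -> dyn (rcons y b) m -> dyn y m.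
Proof.
move=> wy [c H]; have nb : ~~ (b && (size y < w)) by rewrite ltnNge wy andbF.
rewrite ones_rcons // in c H; split=> // j; rewrite (maxn_idPr wy) => /andP[wj jy].
have := H j; rewrite size_rcons wj (maxn_idPr (leqW wy)) leqW // => /(_ isT).
by rewrite undecided_rcons // chosen_frame.
Qed.

(** Appending 0 does not change the trace, so the closure and the bounds at [w] carry over without
    computation. *)
Lemma dyn_skip y m : size y < w -> dyn y m -> dyn (rcons y false) m.
Proof.
move=> yw [c H]; rewrite /dyn ones_rcons //; split=> // j.
rewrite size_rcons (maxn_idPl yw) => jw; have := H j.
rewrite (maxn_idPl (ltnW yw)) => /(_ jw).
by move: jw; rewrite -eqn_leq => /eqP <-; rewrite undecided_rcons // !chosen_w.
Qed.

(** The arrays are written only at the new depth, so the parent's entries stay intact even if the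
    child turns out not to be viable. *)
Lemma extend_spec m y b q : static m -> holds_path (rcons y b) m ->
  dyn y m -> viable y -> size y = w + q ->
  wp extend m (fun m' _ t => [/\ static m', dyn y m',
    m' bOk 0 = viable (rcons y b), viable (rcons y b) -> dyn (rcons y b) m'
    & t <= 100]).
Proof.
move=> sm [h1 h2] [c H] vy sz; have wy : w <= size y by rewrite sz leq_addr.
have nb : ~~ (b && (size y < w)) by rewrite ltnNge wy andbF.
have [mnE mxE] :
    m bMin (size y) = #|cl Sigma (ones Sigma y)| + #|chosen w (size y) y| /\
    m bMax (size y) = #|cl Sigma (ones Sigma y)| + #|chosen w (size y) y| +
                      #|undecided Sigma (size y) y|.
  by apply: H; rewrite wy leq_maxr.
rewrite [X in undecided _ X _]sz undecided_step in mxE.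
have chE : #|chosen w (w + q.+1) (rcons y b)| = b + #|chosen w (size y) y|.
  rewrite chosen_rcons // sz; case: (b); rewrite ?set0U //.
  by rewrite cardsU1 inE ltnn.
have fE : eval m eFree = (q \in free_elts Sigma y).
  case: sm => [im _ _ [_ pq] _]; rewrite /= h1 size_rcons subn1 /= (inputs_w im).
  rewrite sz addKn -addnS addKn pq c nth_chi !inE.
  by case: (q \in premises _); case: (q \in cl _ _).
have bE : m bPath (size y) = b.
  by rewrite h2 ?size_rcons // nth_rcons ltnn eqxx.
have vE := viable_free b vy sz; rewrite chE in vE.
rewrite size_rcons in h1.
apply/wp_seq/wp_set; set m1 := update _ _ _ _.
have m1E b' a : b' != bMin -> m1 b' a = m b' a by rewrite /m1 /update => /negbTE->.
apply/wp_seq/wp_set; set m2 := update _ _ _ _.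
have m2E b' a : b' != bMin -> b' != bMax -> m2 b' a = m b' a.
  by move=> n7 /negbTE n8; rewrite -m1E // /m2 /update n8.
have fE1 : eval m1 eFree = (q \in free_elts Sigma y).
  by rewrite -fE /= !m1E.
have fE2 : eval m2 eFree = (q \in free_elts Sigma y).
  by rewrite -fE /= !m2E.
have mn2 a : m2 bMin a = if a == (size y).+1 then m bMin (size y) + b else m bMin a.
  by rewrite /m2 /m1 /update /= h1 subn1 /= bE.
have mx2 a : m2 bMax a = if a == (size y).+1
    then m bMax (size y) - ((q \in free_elts Sigma y) - b) else m bMax a.
  have xE : eval m1 (ESub (EGet bMax eLast) (ESub eFree (EGet bPath eLast))) =
      m bMax (size y) - ((q \in free_elts Sigma y) - b).
    rewrite -[LHS]/(m1 bMax (m1 bDepth 0 - 1)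
      - (eval m1 eFree - m1 bPath (m1 bDepth 0 - 1))).
    by rewrite fE1 !m1E // h1 subn1 bE.
  rewrite /m2 xE /update [eval m1 _]m1E // h1.
  by have [->|] := eqVneq a (size y).+1; rewrite ?m1E.
apply: wp_set; set e := eval m2 (ESub _ _).
have -> : e = 1 - ((m bMin (size y) + b - k)
    + (k - (m bMax (size y) - ((q \in free_elts Sigma y) - b)))
    + (b - (q \in free_elts Sigma y))).
  rewrite /e -fE2 -[LHS]/(1 - ((m2 bMin (m2 bDepth 0) - m2 0 1)
    + (m2 0 1 - m2 bMax (m2 bDepth 0))
    + (m2 bPath (m2 bDepth 0 - 1) - eval m2 eFree))).
  by rewrite mn2 mx2 fE2 !m2E // h1 subn1 eqxx bE (static_k sm).
have sm2 : static m2.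
  by apply: ready_update => //; apply: ready_update.
split.
- exact: ready_update.
- split; first by move=> a; rewrite /update /= m2E // c.
  move=> j lej; rewrite /update /= mn2 mx2.
  have -> : (j == (size y).+1) = false.
    by move: lej; rewrite (maxn_idPr wy) => /andP[_]; clear; lia.
  exact: H.
(* A free element that is taken moves from the undecided to the chosen ones, which leaves the
   maximum unchanged. *)
- rewrite /update /= vE mnE mxE.
  move: #|cl _ _| #|chosen _ _ _| #|undecided _ _ _|; clear.
  by case: b; case: (q \in _) => A B D /=; lia.
- rewrite vE => /and3P[bF _ _]; split.
    by move=> a; rewrite ones_rcons // /update /= m2E // c.
  move=> j; rewrite size_rcons (maxn_idPr (leqW wy)).
  rewrite undecided_rcons // ones_rcons //.
  case/andP=> wj; rewrite leq_eqVlt ltnS => /orP[/eqP->|jy].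
    rewrite /update /= mn2 mx2 eqxx mnE mxE sz -addnS chE sz.
    move: #|cl _ _| #|chosen _ _ _| #|undecided _ _ _| bF; clear.
    by case: b; case: (q \in _) => A B D //= _; lia.
  rewrite /update /= mn2 mx2 ltn_eqF ?ltnS // chosen_frame //.
  by apply: H; rewrite wj (maxn_idPr wy).
- by [].
Qed.

(** The parent's data are guaranteed beyond depth w and for first children. A second child at depth
    at most w comes after a subtree that may have overwritten the closure; it is either fully
    checked or refused for its bit, and needs no data. *)
Definition state_before y m : Prop :=
  static m /\ forall y' b, y = rcons y' b -> (w < size y) || ~~ b -> dyn y' m.
Definition state_visited y m : Prop := static m /\ dyn y m.
Definition state_after y m : Prop :=
  static m /\ forall y' b, y = rcons y' b -> w < size y -> dyn y' m.

Definition full_check (i : nat) : bool :=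
  (i == 0) || [exists q in premises Sigma, i == q.+1].

Definition test_cost (i : nat) : nat := 200 + full_check i * check_cost.

Lemma test_spec y m : size y <= w + w -> parent_viable y -> holds_path y m ->
  state_before y m ->
  wp (test P) m (fun m' _ t => [/\ m' bOk 0 = viable y,
    if viable y then state_visited y m' else state_after y m'
    & t <= test_cost (size y)]).
Proof.
move=> yn py hm [sm dm]; have [h1 h2] := hm.
apply: wp_if; rewrite /= h1 (ready_w sm).
have [lt|ge] := ltnP w (size y).
  rewrite -lt0n subn_gt0 lt; case/lastP: y lt yn py hm dm h1 h2 => // y b.
  rewrite size_rcons ltnS => wy yn py hm dm _ _.
  have vy := py _ _ erefl.
  have qw : size y - w < w by rewrite ltn_subLR.
  have sz : size y = w + Ordinal qw by rewrite /= subnKC.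
  have dy : dyn y m by apply: (dm y b) => //; rewrite wy.
  apply: wp_conseq (extend_spec sm hm dy vy sz) _ => m' o t _ [sm' dy' ok dyb tle].
  split=> //; last by move: tle; rewrite /test_cost /=; clear; lia.
  case: ifP => [/dyb //|_]; split=> // y' b' /rcons_inj[<- _] _.
  exact: dy'.
move: (ge); rewrite -subn_eq0 => /eqP -> /=.
have Lend m' : static m' -> state_after y m'.
  by move=> sm'; split=> // y' b _; rewrite ltnNge ge.
apply: wp_if; rewrite /= h1.
have [p0 pq] : m bPrem 0 = 1 /\ (forall q, m bPrem q.+1 = (q \in premises Sigma)).
  by case: sm.
have [fc|nfc] := boolP (full_check (size y)).
  have -> : m bPrem (size y) != 0.
    case/orP: fc => [/eqP->|/existsP[q /andP[qp /eqP->]]]; first by rewrite p0.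
    by rewrite pq qp.
  apply: wp_conseq (check_spec sm hm ge) _ => m' o t _ [sm' dy' ok tle].
  have vE : viable y = has_disjoint_extension (Mod Sigma)
      (cl Sigma (ones Sigma y)) (zeros Sigma y) k.
    apply: viable_full => // y' b yE; split; first exact: py yE.
    case/orP: fc => [/eqP|/existsP[q /andP[qp /eqP]]]; rewrite yE size_rcons //.
    by move=> [e]; exists q.
  split; first by rewrite vE.
    by case: ifP => _; [split|apply: Lend].
  by rewrite /test_cost fc /=; move: tle; clear; lia.
case/lastP: y {yn} ge py hm dm h1 h2 Lend nfc => [|y b] //.
rewrite size_rcons => yw py hm dm h1 h2 Lend nfc.
pose q := Ordinal (yw : size y < w).
have qp : q \notin premises Sigma.
  apply: contra nfc => qp; apply/orP; right; apply/existsP; exists q.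
  by rewrite qp /=.
have -> : m bPrem (size y).+1 = 0 by have := pq q => /= ->; rewrite (negbTE qp).
apply: wp_set; rewrite /= h1 subn1 /= h2 ?size_rcons // nth_rcons ltnn eqxx.
have vE := viable_skip b (py _ _ erefl) (erefl : size y = q) qp.
split; last by rewrite /test_cost /=; clear; lia.
- by rewrite vE /update /=; case: (b).
- rewrite vE; have sm' : static (update m bOk 0 (1 - b)) by apply: ready_update.
  case: ifP => nb; last exact: Lend.
  split=> //; have dy : dyn y m by apply: (dm y b) => //; rewrite nb orbT.
  by move: nb; case: (b) => // _; apply: dyn_skip => //; case: dy.
Qed.

Lemma leaf_spec Z m : Z \in S -> holds_path (code Sigma Z) m ->
  state_visited (code Sigma Z) m ->
  wp leaf m (fun m' o t =>
    [/\ o = chi Z, state_after (code Sigma Z) m' & t <= 100 * w.+1]).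
Proof.
move=> ZS [h1 h2] [sm dm].
have ZM : Z \in Mod Sigma by move: ZS; rewrite memS => /andP[].
apply: (wp_forc (fun i m' o => (forall b, b != bQ -> m' b =1 m b) /\
   o = take i (chi Z)) 40 w) => //.
- split; last by rewrite take0.
  by move=> b /negbTE nb a; rewrite /update nb.
- by move=> i m' o _ [fr _] /=; rewrite fr // (ready_w sm).
- move=> i m' o lti vi [fr oE]; pose q := Ordinal lti.
  apply: wp_out; split; last by [].
  split; first by move=> b nb a; rewrite /update (negbTE nb) fr.
  rewrite (take_nth 0) ?size_chi // -cats1 oE; congr (_ ++ [:: _]).
  rewrite -[nth 0 _ i]/(nth 0 (chi Z) q) nth_chi -[LHS]addn0 -[RHS]addn0.
  rewrite (mem_code q ZM) addn0 /= vi !fr // (ready_w sm); case: dm => c _.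
  have -> : m bCl i = (q \in cl Sigma (ones Sigma (code Sigma Z))).
    by rewrite c -nth_chi.
  congr (_ + _).
  by rewrite h2 // size_code ltn_add2l.
- move=> m' o t [fr oE] tle; split.
  + by rewrite oE take_oversize // size_chi.
  + have sm' : static m'.
      apply: ready_frame sm => [b bin|||a wa c0 z0].
      * by apply: fr; move: bin; rewrite !inE; case: (eqVneq b bQ) => [->|].
      * by rewrite fr.
      * by move=> b lb; apply: fr; rewrite gtn_eqF // (ltn_trans _ lb).
      * by rewrite !fr.
    split=> // y' b yE _; case: dm => c H.
    have : dyn (rcons y' b) m' by rewrite -yE; split=> [a|j /H]; rewrite !fr.
    (* The code has length 2w and w > 0, so the parent of a leaf still has depth at least w. *)
    apply: dyn_parent; have := size_code Sigma Z; rewrite yE size_rcons.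
    by move: w_gt0; clear; lia.
  + by move: tle => /=; clear; lia.
Qed.

End Node.

(** * The enumeration program *)

Section Prepare.

Variables (w : nat) (Sigma : seq (implication 'I_w)) (k : nat) (d : seq nat).
Notation h := (size Sigma).
Notation ready := (ready Sigma k d).

Lemma premises_prm : premises Sigma = \bigcup_(j < h) prm Sigma j.
Proof.
rewrite /premises (big_nth (set0, set0)) big_mkord; apply: eq_bigr => j _.
by rewrite /prm (nth_map (set0, set0)).
Qed.

Lemma ready_set A m (q : 'I_w) : ready A m ->
  ready (q |: A) (update m bPrem q.+1 1).
Proof.
move=> [im H0 H1 [p0 pq] tl]; split=> //.
  case: H0 => m40 m43; split=> // b a lb.
  by rewrite /update gtn_eqF ?m43 // (ltn_trans _ lb).
split=> [|q']; first by [].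
rewrite /update /= eqSS !inE -val_eqE /= pq.
by case: eqP.
Qed.

Lemma prepare_spec :
  wp prepare (load (enum_input d Sigma k)) (fun m' _ t =>
    ready (premises Sigma) m' /\ t <= 200 * (h.+1 * w.+1)).
Proof.
do 6 apply/wp_seq/wp_set => /=; set m0 := update _ bRow _ _.
have r0 : ready set0 m0.
  split=> //.
  - split=> [a|b a lb].
      by rewrite /m0 /update /load /=; case: a => [|[|[|a]]] /=; rewrite ?nth_nil.
    have nb c : c < 44 -> (b == c) = false.
      by move=> lc; rewrite gtn_eqF // (leq_trans lc).
    rewrite /m0 /update /load !nb //=.
    by case: b lb {nb} => [|[|[|[|b]]]] //= _; rewrite !nth_nil.
  - split=> //; move=> q; rewrite /m0 /update /load /= inE.
    by rewrite ?nth_nil.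
  - by move=> a _; rewrite /m0 /update /load /= ?nth_nil.
apply: (wp_forc (fun i m' _ => m' bRow 0 = i * w /\
   ready (\bigcup_(j < i) prm Sigma j) m') (100 * w.+1) h) => //.
- by split=> //; rewrite big_ord0; apply: ready_update.
- by move=> i m' _ _ [_ [/inputs_h]].
- move=> i m o lti vi [ri rm]; apply: wp_seq.
  apply: (wp_forc (fun i' m' _ => [/\ m' bRow 0 = i * w, m' bJ 0 = i &
     ready (\bigcup_(j < i) prm Sigma j :|: [set q in prm Sigma i | q < i']) m'])
     40 w) => //.
  + by split=> //; rewrite below0 setU0; apply: ready_update.
  + by move=> i' m' _ _ [_ _ /ready_w].
  + move=> i' m1 o1 lti' vi' [ri1 ji1 rm1]; pose q := Ordinal lti'.
    apply: wp_if; rewrite /= ri1 vi' (below_step _ q).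
    have -> : m1 1 (i * w + i') = (q \in prm Sigma i).
      by case: rm1 => im _ _ _ _; rewrite -(inputs_prm q im lti).
    have [qin|qn] /= := boolP (q \in prm Sigma i); last first.
      apply: wp_skip; split=> //; split=> //; exact: ready_update.
    apply: wp_set; split=> //; split=> //=; rewrite vi' addn1.
    rewrite setUCA -[i'.+1]/(q.+1); apply: ready_update => //.
    exact: ready_set.
  + move=> m1 o1 t1 [ri1 ji1]; rewrite below_all => rm1 t1le.
    apply: wp_set; rewrite /= ri1 (ready_w rm1); split; last first.
      by move: t1le => /=; clear; lia.
    split; first by rewrite mulSn addnC.
    by rewrite big_ord_recr; do 2 apply: ready_update => //.
- move=> m o t [_ rm] tle; rewrite premises_prm; split=> //.
  move: tle (leq_pmulr h.+1 (ltn0Sn w)); rewrite /= mulnDr mulnCA.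
  by move: (h.+1 * w.+1); clear; lia.
Qed.

End Prepare.

(** Union bound: |D| + h is at most the sum of |A| + 1 over the base, hence at most h s; h >= 1
    makes the inequality strict. *)
Lemma card_premises_lt w (Sigma : seq (implication 'I_w)) : 0 < size Sigma ->
  #|premises Sigma| < size Sigma * max_premise_size1 Sigma.
Proof.
move=> h0; suff H : #|premises Sigma| + size Sigma <=
    size Sigma * max_premise_size1 Sigma.
  by apply: leq_trans H; rewrite -addn1 leq_add2l.
have : #|premises Sigma| + size Sigma <= \sum_(r <- Sigma) (#|r.1| + 1).
  rewrite big_split /= sum1_size leq_add2r /premises.
  elim: Sigma {h0} => [|r s IH]; first by rewrite !big_nil cards0.
  by rewrite !big_cons (leq_trans (leq_card_setU _ _)) // leq_add2l.
move/leq_trans; apply; rewrite -sum1_size big_distrl /=.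
rewrite big_seq [X in _ <= X]big_seq.
apply: leq_sum => r rS; rewrite mul1n.
exact: (@leq_bigmax_seq _ _ xpredT (fun r : implication 'I_w => #|r.1| + 1)).
Qed.

(** Each q in [premises] flags the single level q + 1. The root does not occur, as [n - j] is
    positive. *)
Lemma sum_full_check w (Sigma : seq (implication 'I_w)) n :
  \sum_(0 <= j < n) full_check Sigma (n - j) <= #|premises Sigma|.
Proof.
apply: (@leq_trans (\sum_(0 <= j < n) \sum_(q in premises Sigma) (n - j == q.+1))).
  rewrite !big_mkord; apply: leq_sum => j _.
  have nj : (n - j == 0) = false by rewrite subn_eq0 leqNgt ltn_ord.
  rewrite /full_check nj /=.
  case: existsP => // -[q /andP[qp e]].
  by rewrite (bigD1 q) //= e.
rewrite exchange_big -sum1_card /=; apply: leq_sum => q _.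
rewrite big_mkord.
rewrite (eq_bigr (fun j : 'I_n => if n - j == q.+1 then 1 else 0)); last first.
  by move=> j _; case: (_ == _).
rewrite -big_mkcond sum1_card; apply/card_le1_eqP => j1 j2; rewrite !unfold_in.
move=> /eqP e1 /eqP e2; apply/val_inj => /=.
by move: (ltn_ord j1) (ltn_ord j2) e1 e2; clear; lia.
Qed.

Lemma subtree_costE n a u m : subtree_cost n a u m =
  u + 30 + \sum_(0 <= j < m) 2 * (a (n - j) + 60).
Proof.
elim: m => [|m IH]; first by rewrite big_geq ?addn0.
by rewrite big_nat_recr //= IH addnA.
Qed.

Section Enumeration.

Variables (w : nat) (Sigma : seq (implication 'I_w)) (k : nat) (d : seq nat).
Variables (P : cmd) (tau : nat).

Notation h := (size Sigma).
Notation S := (members_of_size (Mod Sigma) k).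

Hypothesis h_gt0 : 0 < h.
Hypothesis w_gt0 : 0 < w.
Hypothesis oracle : forall Z Y, Z \in Mod Sigma -> exists2 t, t <= tau &
  runs P (check_input d Z Y k)
    [:: nat_of_bool (has_disjoint_extension (Mod Sigma) Z Y k)] t.

Lemma ready_agree A m m' : agree_off m m' -> ready Sigma k d A m ->
  ready Sigma k d A m'.
Proof.
move=> ag; apply: ready_frame => [b bin||b lb|a wa c0 z0].
- apply: ag; have /allP/(_ _ bin) : all (fun b =>
    b \notin [:: bDepth; bPath; bMode; bRun; bOk]) [:: 0; 1; 2; 3; 6; 19; 40] by [].
  by [].
- exact: ag.
- by apply: ag; rewrite !inE !gtn_eqF ?(ltn_trans _ lb).
- by rewrite !ag.
Qed.

Lemma dyn_agree y m m' : agree_off m m' -> dyn Sigma y m -> dyn Sigma y m'.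
Proof. by move=> ag [c H]; split=> [a|j /H]; rewrite !ag. Qed.

Lemma writes_test b : b \in [:: bDepth; bPath; bMode; bRun] -> ~~ writes (test P) b.
Proof.
move=> bin; have : ~~ writes (call P) b.
  have /allP/(_ _ bin)/and3P[b1 b2 b3] : all (fun b => [&& b < 40, b != 3 &
    b \notin [:: bAddr; bBank; bOld; bLog; bRes]])
    [:: bDepth; bPath; bMode; bRun] by [].
  exact: writes_call.
move: bin; rewrite !inE => /or4P[] /eqP-> /= /negbTE ->.
- by [].
- by [].
- by [].
- by [].
Qed.

Lemma silent_test : silent (test P).
Proof. by have := silent_call P; rewrite /= => ->. Qed.

Lemma subtree_test_cost :
  subtree_cost (w + w) (test_cost Sigma P tau) (100 * w.+1) (w + w) <=
  2 * check_cost Sigma P tau * (h * max_premise_size1 Sigma).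
Proof.
rewrite subtree_costE /test_cost.
set CC := check_cost _ _ _; set hs := h * _.
(* 520 is 2(200 + 60): the cheap part of a test and its loop overhead, for two children. *)
rewrite (eq_bigr (fun j => 520 + 2 * CC * full_check Sigma (w + w - j))); last first.
  by move=> j _; rewrite mulnC; clear; lia.
rewrite big_split /= sum_nat_const_nat subn0 -big_distrr /=.
have := sum_full_check Sigma (w + w); set s := \sum_(_ <= _ < _) _ => sle.
have := card_premises_lt h_gt0; rewrite -/hs => /(leq_ltn_trans sle) s_hs.
have : 2 * CC * s.+1 <= 2 * CC * hs by rewrite leq_mul2l s_hs orbT.
have : 2400 * w + 1000 <= CC.
  rewrite /CC /check_cost; have := leq_pmull w h_gt0.
  by move: (_ * tau.+1) (h * w); clear; lia.
rewrite mulnS; move: (2 * CC * s) (2 * CC * hs); clear; lia.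
Qed.

Lemma enumeration_spec :
  wp (enumeration P) (load (enum_input d Sigma k)) (fun m' o t =>
    exists l, [/\ uniq l, l =i S, o = chis l &
      t <= 8 * 1000 * (size (banks P)).+1 *
        ((#|S| + 1) * h * max_premise_size1 Sigma * (h * w + tau))]).
Proof.
apply: wp_seq; apply: wp_conseq (prepare_spec Sigma k d) _ => m1 o1 t1 E1 [r1 t1le].
have -> := exec_silent E1 isT.
apply: wp_conseq (@trie_search_spec _ S (w + w) (code Sigma) (@chi w) (test P) leaf
  (test_cost Sigma P tau) (100 * w.+1) (state_before Sigma k d)
  (state_visited Sigma k d) (state_after Sigma k d)
  _ _ _ _ _ _ _ _ _ _ _ _ _ m1 _) _.
- by move=> Z _; apply: size_code.
- exact: code_inj.
- move=> y m m' ag [sm dm]; split; last first.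
    by move=> y' b yE /(dm _ _ yE); apply: dyn_agree.
  exact: ready_agree sm.
- move=> y m m' ag [sm dm]; split; last first.
    by move=> y' b yE /(dm _ _ yE); apply: dyn_agree.
  exact: ready_agree sm.
- by move=> y m [[_ _ [_ ->]]].
- by move=> y m _ [sm dm]; split=> // y' b /rcons_inj[<- _].
- move=> y m _ _ [sm dm]; split=> // y' b /rcons_inj[<- <-].
  by rewrite orbF size_rcons => wy; apply: (dm y false); rewrite ?size_rcons.
- move=> y m _ [sm dm]; split=> // y' b yE wy.
  have dy : dyn Sigma y m by apply: (dm y true) => //; rewrite size_rcons ltnW.
  by apply: (@dyn_parent _ _ _ b); [move: wy; rewrite yE size_rcons | rewrite -yE].
- exact: silent_test.
- by apply/allP => b; apply: writes_test.
- by [].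
- exact: test_spec.
- exact: leaf_spec.
- move=> m' ag; split; last by case.
  exact: ready_agree r1.
move=> m2 o2 t2 _ [l [ul lS -> t2le]]; exists l; split=> //.
have -> : #|S| = size l by rewrite -(card_uniqP ul); apply: eq_card => Z; rewrite lS.
set B := (size (banks P)).+1; set hs := max_premise_size1 _.
have cost := subtree_test_cost; rewrite -/hs in cost.
have hs0 : 0 < h * hs by apply: leq_ltn_trans (card_premises_lt h_gt0).
have hw0 : 0 < h * w by rewrite muln_gt0 h_gt0.
(* Here h w >= 1 absorbs the additive constants and the successor of [tau]. *)
have CCle : check_cost Sigma P tau <= 3600 * (B * (h * w + tau)).
  rewrite /check_cost -/B -mulnA.
  have : h * w + tau <= B * (h * w + tau) by apply: leq_pmull.
  have : B * tau.+1 <= B * (h * w + tau).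
    by rewrite leq_mul2l /= -add1n leq_add2r.
  by move: hw0; clear; lia.
(* The preparation costs no more than one full check, so that it and the test of the root fit into
   the summand 1 of N + 1. *)
have preple : 200 * (h.+1 * w.+1) + 300 <= check_cost Sigma P tau.
  have : h.+1 * w.+1 <= (2 * h) * (2 * w).
    by apply: leq_mul; [move: h_gt0 | move: w_gt0]; clear; lia.
  rewrite /check_cost; move: hw0; rewrite mulnACA.
  by move: (_ * tau.+1) (h * w); clear; lia.
have a0 : test_cost Sigma P tau 0 = 200 + check_cost Sigma P tau.
  by rewrite /test_cost /full_check eqxx mul1n.
rewrite a0 in t2le.
move: (check_cost _ _ _) cost CCle preple t2le => CC cost CCle preple t2le.
have : size l * subtree_cost (w + w) (test_cost Sigma P tau) (100 * w.+1) (w + w)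
    <= size l * (2 * CC * (h * hs)) by rewrite leq_mul2l cost orbT.
have : CC <= CC * (h * hs) by apply: leq_pmulr.
have : CC * ((size l + 1) * (h * hs)) <=
    3600 * (B * (h * w + tau)) * ((size l + 1) * (h * hs)).
  by rewrite leq_mul2r CCle orbT.
rewrite -!mulnA.
have -> : size l * (2 * (CC * (h * hs))) = 2 * (CC * (size l * (h * hs))) by lia.
have -> : CC * ((size l + 1) * (h * hs)) =
    CC * (size l * (h * hs)) + CC * (h * hs) by lia.
have -> : 3600 * (B * ((h * w + tau) * ((size l + 1) * (h * hs)))) =
    3600 * (B * ((size l + 1) * (h * (hs * (h * w + tau))))) by lia.
move: t1le t2le preple; move: (B * _) (CC * (h * hs)) (CC * (size l * _)).
by move: (size l * _); clear; lia.
Qed.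

End Enumeration.

Theorem theorem2 (R : realType) (F : closure_family) (c : R)
    (F_unbounded : unbounded_universes F)
    (c_ge1 : (1 <= c)%R)
    (F_dep : disjoint_extension_property F c) :
  exists (A : cmd) (K : R),
    forall (i : fam_idx F) (Sigma : seq (implication 'I_(fam_size i))) (k : nat),
      implicational_base Sigma (fam_sys i) ->
      1 <= size Sigma ->
      1 <= k <= fam_size i ->
      let w := fam_size i in
      let h := size Sigma in
      let s := max_premise_size1 Sigma in
      let N := #|members_of_size (fam_sys i) k| in
      exists (out : seq nat) (t : nat),
        [/\ runs A (enum_input (fam_code i) Sigma k) out t,
            enumerates out (members_of_size (fam_sys i) k)
          & (t%:R <= K * ((N + 1)%:R * h%:R * s%:R
                          * ((h * w)%:R + w%:R `^ c)))%R].
Proof.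
have [P [K0 HP]] := F_dep.
(* The maximum with 1 serves the term h w, which does not come with a factor [K0]. *)
exists (enumeration P), ((8 * 1000 * (size (banks P)).+1)%:R * Num.max 1 K0)%R.
move=> i Sigma k base h_gt0 /andP[k_gt0 k_le] w h s N.
have w_gt0 : 0 < w := leq_trans k_gt0 k_le.
pose x := (K0 * w%:R `^ c)%R.
(* [K0] is not assumed nonnegative; a run on the full set, a member of every closure system, shows
   that the bound is. *)
have x_ge0 : (0 <= x)%R.
  have [t [_ tx]] := HP i w_gt0 setT set0 (proj1 (fam_closure i)) k k_le.
  exact: le_trans (ler0n _ t) tx.
(* Running times are integers, so truncating the real bound loses nothing. *)
have oracle Z Y : Z \in Mod Sigma -> exists2 t, t <= Num.trunc x &
    runs P (check_input (fam_code i) Z Y k)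
      [:: nat_of_bool (has_disjoint_extension (Mod Sigma) Z Y k)] t.
  rewrite -base => Zi; have [t [rt tx]] := HP i w_gt0 Z Y Zi k k_le.
  by exists t; rewrite ?truncn_ge_nat.
have [m [o [t [E [l [ul lS oE tle]]]]]] := enumeration_spec h_gt0 w_gt0 oracle.
rewrite -base in lS tle.
exists o, t; split; [by exists m | by exists l |].
rewrite -(ler_nat R) in tle; apply: le_trans tle _.
set b := 8 * 1000 * _; rewrite (natrM _ b) -[leRHS]mulrA.
apply: ler_wpM2l; rewrite ?ler0n // mulrCA !natrM.
apply: ler_wpM2l; rewrite ?mulr_ge0 ?ler0n // natrD mulrDr; apply: lerD.
  by rewrite natrM ler_peMl ?mulr_ge0 ?ler0n // le_max lexx.
apply: (@le_trans _ _ x); first by rewrite truncn_le.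
by apply: ler_wpM2r; rewrite ?powR_ge0 // le_max lexx orbT.
Qed.
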